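(* Let $\kappa$ be an infinite field and $R=\kappa[x_1,\dots,x_n]$ with the standard grading. Suppose that $I\subseteq R$ is an unmixed ideal possessing a nondegenerate geometric vertex decomposition with respect to some variable $y=x_j$ of $R$. If $N_{y,I}$ is unmixed, then there is an isomorphism $I/N_{y,I}\cong C_{y,I}/N_{y,I}$ of $R/N_{y,I}$-modules. If $N_{y,I}$, $C_{y,I}$, and $I$ are homogeneous, then the same map is an isomorphism $I/N_{y,I}\cong[C_{y,I}/N_{y,I}](-1)$ in the category of graded $R/N_{y,I}$-modules.
   Context: Let $y=x_j$ be a variable of $R$. For nonzero $f=\sum_{i=0}^d\alpha_i y^i\in R$ with $\alpha_i\in\kappa[x_1,\dots,\widehat{y},\dots,x_n]$ and $\alpha_d\neq0$, the initial $y$-form is $\operatorname{in}_y f=\alpha_d y^d$; for an ideal $J$, $\operatorname{in}_y J=\langle \operatorname{in}_y f\mid f\in J\rangle$. A monomial order $<$ is $y$-compatible if $\operatorname{in}_<f=\operatorname{in}_<(\operatorname{in}_yf)$ for all $f$. Given an ideal $I\subseteq R$ and a Gr\''obner basis $\{y^{d_i}q_i+r_i\mid 1\le i\le m\}$ of $I$ with respect to a $y$-compatible order, where $q_i$ does not involve $y$ and $\operatorname{in}_y(y^{d_i}q_i+r_i)=y^{d_i}q_i$, define $C_{y,I}=\langle q_i\mid 1\le i\le m\rangle$ and $N_{y,I}=\langle q_i\mid d_i=0\rangle$ (ideals of $R$, independent of choices; one has $N_{y,I}\subseteq I\cap C_{y,I}$). If $\operatorname{in}_yI=C_{y,I}\cap(N_{y,I}+\langle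 y\rangle)$, this equality is a geometric vertex decomposition of $I$ with respect to $y$; it is degenerate if $\sqrt{C_{y,I}}=\sqrt{N_{y,I}}$ or $C_{y,I}=\langle1\rangle$, and nondegenerate otherwise. An ideal $J$ is unmixed if $\dim(R/P)=\dim(R/J)$ for every $P\in\operatorname{Ass}(R/J)$. *)

(* Defs.v *)
From HB Require Import structures.
From mathcomp Require Import all_boot all_order all_algebra.
From mathcomp Require Import ring_quotient boolp mpoly.

Set Implicit Arguments.
Unset Strict Implicit.
Unset Printing Implicit Defensive.

Import GRing.Theory.

Local Open Scope ring_scope.
Local Open Scope quotient_scope.

(* MathComp's idealr only covers proper ideals with decidable membership.
   Membership is boolean here too, but ideal_span below turns any Prop-valued
   set of generators into an ideal by classical logic. *)
Record ideal (R : comPzRingType) := Ideal {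
  ideal_pred :> {pred R};
  ideal_closed : 0 \in ideal_pred /\
    forall a, {in ideal_pred &, forall u v, a * u + v \in ideal_pred}
}.

Section Ideals.
Variable R : comPzRingType.
Implicit Types (S : R -> Prop) (J K P : ideal R).

Lemma ideal_zmod_closed J : zmod_closed (ideal_pred J).
Proof.
case: (ideal_closed J) => J0 JD; split=> // u v uJ vJ.
by rewrite addrC -mulN1r JD.
Qed.
HB.instance Definition _ J :=
  GRing.isZmodClosed.Build R (ideal_pred J) (ideal_zmod_closed J).

Lemma idealM J a u : u \in ideal_pred J -> a * u \in ideal_pred J.
Proof.
by case: (ideal_closed J) => J0 JD uJ; rewrite -[a * u]addr0 JD.
Qed.

Definition in_span S (f : R) : Prop :=
  exists2 s : seq (R * R), (forall x, x \in s -> S x.2) &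
    f = \sum_(x <- s) x.1 * x.2.

Lemma span_closed S : let p : {pred R} := fun f => `[< in_span S f >] in
  0 \in p /\ forall a, {in p &, forall u v, a * u + v \in p}.
Proof.
split; first by apply/asboolP; exists [::]; rewrite ?big_nil.
move=> a u v /asboolP[s sS ->] /asboolP[t tS ->]; apply/asboolP.
exists ([seq (a * x.1, x.2) | x <- s] ++ t).
  move=> x; rewrite mem_cat => /orP[/mapP[z zs ->]|/tS//]; exact: sS zs.
rewrite big_cat big_map /= mulr_sumr; congr (_ + _).
by apply: eq_bigr => x _; rewrite mulrA.
Qed.
Definition ideal_span S : ideal R := Ideal (span_closed S).

Definition ideal_add J K : ideal R :=
  ideal_span (fun f => f \in J \/ f \in K).

Definition in_radical J (f : R) : Prop := exists k : nat, f ^+ k \in J.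

Definition prime_ideal P : Prop :=
  1 \notin P /\ forall f g, f * g \in P -> f \in P \/ g \in P.

Definition strict_subideal J K : Prop :=
  {subset J <= K} /\ exists2 f, f \in K & f \notin J.

Definition prime_chain (d : nat) : Prop :=
  exists2 P : nat -> ideal R, (forall i, (i <= d)%N -> prime_ideal (P i)) &
    forall i, (i < d)%N -> strict_subideal (P i) (P i.+1).

End Ideals.

(* The Krull dimension of A is the supremum of the d such that A has a chain
   P_0 < ... < P_d of primes.  Those d form an initial segment of nat, so two
   dimensions are equal (as elements of {-oo, 0, 1, ..., +oo}) iff the two
   segments coincide. *)
Definition eq_krull_dim (A B : comPzRingType) : Prop :=
  forall d, prime_chain A d <-> prime_chain B d.

Section Quotients.
Variable R : comPzRingType.

Definition quo (J : ideal R) : Type := Quotient.quot (ideal_pred J).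
HB.instance Definition _ J := GRing.Zmodule.on (quo J).

Definition cls (J : ideal R) (f : R) : quo J :=
  \pi_(Quotient.quot (ideal_pred J)) f.

Section QuotientRing.
Variable J : ideal R.

Lemma cls_eq f g : (cls J f = cls J g) <-> (f - g \in ideal_pred J).
Proof.
rewrite Quotient.idealrBE; split=> [fg|/eqP fg]; last exact: fg.
by apply/eqP; exact: fg.
Qed.

Lemma clsP (x : quo J) : {f | x = cls J f}.
Proof.
by exists (repr (x : Quotient.quot (ideal_pred J))); rewrite /cls reprK.
Qed.

Lemma clsB : zmod_morphism (cls J).
Proof. by move=> f g; rewrite /cls raddfB. Qed.
HB.instance Definition _ :=
  GRing.isZmodMorphism.Build R (quo J) (cls J) clsB.

Definition quo_mul (x y : quo J) : quo J :=
  cls J (sval (clsP x) * sval (clsP y)).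

Lemma cls_mul f g : cls J (f * g) = quo_mul (cls J f) (cls J g).
Proof.
rewrite /quo_mul; case: clsP => f' /= /cls_eq ff'; case: clsP => g' /= /cls_eq gg'.
apply/cls_eq; rewrite -(subrKA (f * g')) -mulrBr -mulrBl.
by rewrite [(f - f') * g']mulrC rpredD ?idealM.
Qed.

Lemma quo_mulA : associative quo_mul.
Proof.
move=> x y z; case: (clsP x) (clsP y) (clsP z) => f -> [g ->] [h ->].
by rewrite -!cls_mul mulrA.
Qed.
Lemma quo_mulC : commutative quo_mul.
Proof.
by move=> x y; case: (clsP x) (clsP y) => f -> [g ->]; rewrite -!cls_mul mulrC.
Qed.
Lemma quo_mul1 : left_id (cls J 1) quo_mul.
Proof. by move=> x; case: (clsP x) => f ->; rewrite -cls_mul mul1r. Qed.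
Lemma quo_mulDl : left_distributive quo_mul +%R.
Proof.
move=> x y z; case: (clsP x) (clsP y) (clsP z) => f -> [g ->] [h ->].
by rewrite -(raddfD (cls J)) -!cls_mul -(raddfD (cls J)) mulrDl.
Qed.
HB.instance Definition _ := GRing.Zmodule_isComPzRing.Build (quo J)
  quo_mulA quo_mulC quo_mul1 quo_mulDl.

Lemma cls_monoid : monoid_morphism (cls J).
Proof. by split=> // f g; rewrite cls_mul. Qed.
HB.instance Definition _ :=
  GRing.isMonoidMorphism.Build R (quo J) (cls J) cls_monoid.

End QuotientRing.

Section QuotientModule.
Variables K N : ideal R.

(* The submodule K/N of R/N, for N contained in K; in general this is
   (K + N)/N. *)
Definition quo_sub_pred : {pred (quo N)^o} :=
  fun x => `[< exists2 f, f \in K & x = cls N f >].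

Lemma quo_sub_closed : submod_closed quo_sub_pred.
Proof.
split; first by apply/asboolP; exists 0; rewrite ?rpred0 ?raddf0.
move=> a x y /asboolP[f fK ->] /asboolP[g gK ->]; apply/asboolP.
case: (clsP a) => c ->; exists (c * f + g); first by rewrite rpredD ?idealM.
by rewrite rmorphD rmorphM.
Qed.
HB.instance Definition _ :=
  GRing.isSubmodClosed.Build (quo N) (quo N)^o quo_sub_pred quo_sub_closed.

Definition quo_mod : Type := {x : (quo N)^o | x \in quo_sub_pred}.
HB.instance Definition _ := SubChoice.on quo_mod.
HB.instance Definition _ := [SubChoice_isSubZmodule of quo_mod by <:].
HB.instance Definition _ := [SubZmodule_isSubLmodule of quo_mod by <:].

End QuotientModule.
End Quotients.

Definition associated_prime (R : comPzRingType) (J P : ideal R) : Prop :=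
  prime_ideal P /\
  exists x : quo J, forall f, f \in P <-> cls J f * x = 0.

Definition unmixed (R : comPzRingType) (J : ideal R) : Prop :=
  forall P, associated_prime J P -> eq_krull_dim (quo P) (quo J).

Section Polynomials.
Variables (k : fieldType) (n : nat).
Local Notation R := {mpoly k[n]}.
Implicit Types (le : rel 'X_{1..n}) (j : 'I_n) (I J C N : ideal R).

Definition monomial_order le : Prop :=
  [/\ reflexive le, antisymmetric le, transitive le, total le &
      (forall m, le 0%MM m) /\
      (forall m m1 m2, le m1 m2 -> le (m + m1)%MM (m + m2)%MM)].

(* The maximum over msupp f; 0%MM is the least monomial, and a junk value if
   f = 0. *)
Definition leading_mnm le (f : R) : 'X_{1..n} :=
  foldr (fun m m' => if le m' m then m else m') 0%MM (msupp f).

Definition initial_term le (f : R) : R :=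
  f@_(leading_mnm le f) *: 'X_[leading_mnm le f].

Definition initial_ideal le J : ideal R :=
  ideal_span (fun g => exists2 f, f \in J & g = initial_term le f).

Definition degree_in j (f : R) : nat :=
  (\max_(m <- msupp f) m j)%N.

Definition initial_form j (f : R) : R :=
  \sum_(m <- msupp f | m j == degree_in j f) f@_m *: 'X_[m].

Definition initial_form_ideal j J : ideal R :=
  ideal_span (fun g => exists2 f, f \in J & g = initial_form j f).

Definition compatible j le : Prop :=
  forall f : R, initial_term le f = initial_term le (initial_form j f).

Definition free_of j (f : R) : Prop := forall m, m \in msupp f -> m j = 0%N.

(* { y ^ d_i q_i + r_i } is a Groebner basis of I of the required shape, for
   y = 'X_j. *)
Definition y_groebner_basis le j I (m : nat)
    (d : 'I_m -> nat) (q r : 'I_m -> R) : Prop :=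
  let g i := 'X_j ^+ d i * q i + r i in
  [/\ forall i, free_of j (q i),
      forall i, initial_form j (g i) = 'X_j ^+ d i * q i,
      forall i, g i \in I /\ g i != 0 &
      initial_ideal le I =i
        ideal_span (fun f => exists i, f = initial_term le (g i))].

Definition C_ideal (m : nat) (q : 'I_m -> R) : ideal R :=
  ideal_span (fun f => exists i, f = q i).

Definition N_ideal (m : nat) (d : 'I_m -> nat) (q : 'I_m -> R) : ideal R :=
  ideal_span (fun f => exists2 i, d i = 0%N & f = q i).

Definition geometric_vertex_decomposition j I C N : Prop :=
  initial_form_ideal j I =i
    [predI C & ideal_add N (ideal_span (fun f => f = 'X_j))].

Definition degenerate C N : Prop :=
  (forall f, in_radical C f <-> in_radical N f) \/ C =i predT.

Definition homogeneous J : Prop :=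
  J =i ideal_span (fun f => f \in J /\ exists d : nat, f \is d.-homog).

(* The degree e component of K/N. *)
Definition quo_component (K N : ideal R) (e : int) (x : quo_mod K N) : Prop :=
  match e with
  | Posz d => exists f, [/\ f \in K, f \is d.-homog & val x = cls N f]
  | Negz _ => x = 0
  end.

(* An isomorphism K/N -> (K'/N)(-1) of graded modules, given that phi is an
   isomorphism of modules: phi and its inverse preserve degrees, where the
   degree e component of M(-1) is that of M in degree e - 1. *)
Definition graded_shifted (K K' N : ideal R) (phi : quo_mod K N -> quo_mod K' N)
    : Prop :=
  forall (e : int) x, quo_component e x <-> quo_component (e - 1) (phi x).

End Polynomials.

(* Main.v *)
(* Write y = 'X_j.  The decomposition in_y I = C /\ (N + <y>) makes I generated
   by elements y c + r with c, r free of y, and the c that occur generate C.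
   For two such elements, (y c + r) c' - (y c' + r') c = r c' - r' c is free of
   y and in I, hence in N; so modulo N the ratio of c to y c + r does not depend
   on the element, and multiplication by c / (y c + r) sends I/N to C/N.  This
   is well defined and injective as soon as (N : I) = N = (N : C), that is, if
   no associated prime P of N contains I or C.

   Suppose such a P exists.  Unmixedness of N makes P minimal over N, and P is
   extended from the polynomials free of y; it follows that P contains both I
   and C.  Then P is associated to I as well, so R/I and R/N have the same
   dimension, and by unmixedness of I every associated prime of I is one of N.
   All of these contain C, whence C and N have the same radical: the
   decomposition is degenerate. *)
Require Import Defs.
From HB Require Import structures.
From mathcomp Require Import all_boot all_order all_algebra.
From mathcomp Require Import ring_quotient boolp mpoly.

Set Implicit Arguments.
Unset Strict Implicit.
Unset Printing Implicit Defensive.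

Import GRing.Theory.

Local Open Scope ring_scope.

(** * Monomial orders and Dickson's lemma *)

(** Each chosen index minimizes [h] over the tail from which it is taken, so every later choice has
    at least the same value. *)
Lemma nondecreasing_subsequence (h : nat -> nat) :
  exists2 g : nat -> nat, (forall i, (g i < g i.+1)%N) &
    forall i, (h (g i) <= h (g i.+1))%N.
Proof.
have min_from i : exists p, (i <= p)%N /\ forall p', (i <= p' -> h p <= h p')%N.
  pose attained v := `[< exists2 p, (i <= p)%N & h p = v >].
  have ex : exists v, attained v by exists (h i); apply/asboolP; exists i.
  case: (ex_minnP ex) => v /asboolP[p ip <-] pmin.
  by exists p; split=> // p' ip'; apply: pmin; apply/asboolP; exists p'.
have [p pP] := choice min_from.
pose g := fix g i := if i is i'.+1 then p (g i').+1 else p 0%N.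
have gS i : (g i < g i.+1)%N by case: (pP (g i).+1).
exists g => // i; have gmin p' : (g i <= p')%N -> (h (g i) <= h p')%N.
  case: i => [|i] /= le_p; first by case: (pP 0%N) => _; apply.
  by case: (pP (g i).+1) => lt_g; apply; exact: leq_trans lt_g le_p.
exact/gmin/ltnW/gS.
Qed.

Lemma increasing_homo (g : nat -> nat) :
  (forall i, (g i < g i.+1)%N) -> {homo g : i j / (i < j)%N}.
Proof. by move=> gS; apply: homo_ltn => // x y z; exact: ltn_trans. Qed.

Lemma dickson n (u : nat -> 'X_{1..n}) :
  exists i j, (i < j)%N /\ (u i <= u j)%MM.
Proof.
(* Coordinates are treated one at a time: a further subsequence, nondecreasing in coordinate [t],
   stays nondecreasing in the earlier ones. *)
suff sub t : exists2 g : nat -> nat, (forall i, (g i < g i.+1)%N) &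
    forall i (l : 'I_n), (l < t)%N -> (u (g i) l <= u (g i.+1) l)%N.
  have [g gS gu] := sub n; exists (g 0%N), (g 1%N); split=> //.
  by apply/mnm_lepP => l; apply: gu.
elim: t => [|t [g gS gu]]; first by exists id.
have [tn|nt] := ltnP t n; last first.
  exists g => // i l lt_l; apply: gu.
  by rewrite (leq_trans (ltn_ord l)).
have [e eS eu] := nondecreasing_subsequence (fun i => u (g i) (Ordinal tn)).
exists (g \o e) => [i|i l]; first exact/(increasing_homo gS).
rewrite ltnS leq_eqVlt => /predU1P[lt_eq|lt_l].
  by rewrite (_ : l = Ordinal tn) ?eu //; exact: val_inj.
have gh i1 i2 : (i1 <= i2)%N -> (u (g i1) l <= u (g i2) l)%N.
  have tr : forall y x z, (x <= y -> y <= z -> x <= z)%N by exact: leq_trans.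
  exact: (homo_leq (f := fun i => u (g i) l) leqnn tr (fun i => gu i l lt_l)).
exact/gh/ltnW.
Qed.

Section MonomialOrder.
Variables (n : nat) (le : rel 'X_{1..n}).
Hypothesis le_order : monomial_order le.

Definition mnm_lt (m1 m2 : 'X_{1..n}) : bool := le m1 m2 && (m1 != m2).

Lemma monomial_order_lepm m1 m2 : (m1 <= m2)%MM -> le m1 m2.
Proof.
case: le_order => _ _ _ _ [le0 leD] /submK <-.
by rewrite -{1}[m1]addm0 [X in le _ X]addmC leD.
Qed.

Lemma monomial_order_anti m1 m2 : le m1 m2 -> le m2 m1 -> m1 = m2.
Proof. by case: le_order => _ anti *; apply: anti; apply/andP. Qed.

Lemma mnm_lt_trans : transitive mnm_lt.
Proof.
have [_ _ tr _ _] := le_order.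
move=> m2 m1 m3 /andP[l12 n12] /andP[l23 n23]; apply/andP; split.
  exact: tr l23.
apply: contraNneq n12 => eq13; apply/eqP; apply: monomial_order_anti => //.
by rewrite eq13.
Qed.

(** An inaccessible monomial starts an infinite strictly descending sequence. By Dickson's lemma
    some term divides a later one, so it is also below it, against antisymmetry. *)
Lemma mnm_lt_wf : well_founded mnm_lt.
Proof.
apply: contrapT => /existsNP[x0 nacc0].
have step x : exists y, ~ Acc mnm_lt x -> mnm_lt y x /\ ~ Acc mnm_lt y.
  have [acc|nacc] := EM (Acc mnm_lt x); first by exists x.
  apply: contrapT => /forallNP noy; apply: nacc; constructor=> y lt_yx.
  by apply: contrapT => naccy; apply: (noy y).
have [s sP] := choice step.
have nacc i : ~ Acc mnm_lt (iter i s x0) by elim: i => //= i /sP[].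
have desc i j : (i < j)%N -> mnm_lt (iter j s x0) (iter i s x0).
  elim: j => // j IH; rewrite ltnS leq_eqVlt => /predU1P[->|/IH lt_ji].
    by case: (sP _ (nacc j)).
  by apply: mnm_lt_trans lt_ji; case: (sP _ (nacc j)).
have [i [j [/desc/andP[le_ji /eqP]]]] := dickson (fun i => iter i s x0).
move=> ne /monomial_order_lepm le_ij; apply: ne.
exact: monomial_order_anti.
Qed.

Variable k : fieldType.
Implicit Types f g : {mpoly k[n]}.

Lemma leading_mnmP f : f != 0 ->
  leading_mnm le f \in msupp f /\
  {in msupp f, forall m, le m (leading_mnm le f)}.
Proof.
have [re an tr tot [le0 _]] := le_order.
rewrite -msupp_eq0 /leading_mnm; elim: (msupp f) => //= m s IH _.
have [->|/IH[lead_s lead_max]] := eqVneq s [::].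
  rewrite /= le0 mem_head; split=> // m'.
  by rewrite inE => /eqP->; exact: re.
case: ifPn => le_m; split; rewrite ?mem_head //.
- move=> m'; rewrite inE => /predU1P[->|/lead_max le_m']; first exact: re.
  exact: tr le_m.
- by rewrite inE lead_s orbT.
move=> m'; rewrite inE => /predU1P[->|/lead_max//].
by have := tot m (foldr (fun m0 m' => if le m' m0 then m0 else m') 0%MM s);
  rewrite (negPf le_m) orbF.
Qed.

Lemma leading_coeff_neq0 f : f != 0 -> f@_(leading_mnm le f) != 0.
Proof. by case/leading_mnmP; rewrite mcoeff_msupp. Qed.

(** One step of division by [g]. Exponents are subtracted with truncation; the leading monomial of
    [g] is expected to divide that of [f], and then the leading terms cancel. *)
Definition lead_reduce f g : {mpoly k[n]} :=
  f - (f@_(leading_mnm le f) / g@_(leading_mnm le g)) *: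
      'X_[leading_mnm le f - leading_mnm le g] * g.

Lemma lead_reduce_lt f g : f != 0 -> g != 0 ->
  (leading_mnm le g <= leading_mnm le f)%MM -> lead_reduce f g != 0 ->
  mnm_lt (leading_mnm le (lead_reduce f g)) (leading_mnm le f).
Proof.
move=> f0 g0 le_gf h0; set h := lead_reduce f g in h0 *.
have [_ _ _ _ [_ leD]] := le_order.
have [_ fmax] := leading_mnmP f0; have [_ gmax] := leading_mnmP g0.
have [hsupp _] := leading_mnmP h0.
have coefXg m : ('X_[leading_mnm le f - leading_mnm le g] * g)@_m != 0 ->
    exists2 m', m' \in msupp g & m = (leading_mnm le f - leading_mnm le g + m')%MM.
  rewrite -mcoeff_msupp mulrC (perm_mem (msuppMX _ _)) => /mapP[m' gm' ->].
  by exists m'.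
apply/andP; split.
  have : h@_(leading_mnm le h) != 0 by rewrite -mcoeff_msupp.
  have [|fm _] := eqVneq (f@_(leading_mnm le h)) 0; last first.
    by apply: fmax; rewrite mcoeff_msupp.
  rewrite {1}/h /lead_reduce mcoeffB => -> /=.
  rewrite sub0r oppr_eq0 -scalerAl mcoeffZ mulf_eq0 negb_or => /andP[_].
  case/coefXg => m' /gmax le_m' ->.
  by rewrite -{2}(submK le_gf) leD.
apply/eqP => eq_lead; move: hsupp; rewrite eq_lead mcoeff_msupp /h /lead_reduce.
rewrite mcoeffB -scalerAl mcoeffZ.
have -> : ('X_[leading_mnm le f - leading_mnm le g] * g)@_(leading_mnm le f) =
    g@_(leading_mnm le g).
  by rewrite mulrC -{1}(submK le_gf) mcoeffMX.
by rewrite divfK ?leading_coeff_neq0 // subrr eqxx.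
Qed.

End MonomialOrder.

Lemma idealD (A : comPzRingType) (J : ideal A) f g :
  f \in J -> g \in J -> f + g \in J.
Proof. exact: rpredD. Qed.

Lemma idealB (A : comPzRingType) (J : ideal A) f g :
  f \in J -> g \in J -> f - g \in J.
Proof. exact: rpredB. Qed.

Lemma idealN (A : comPzRingType) (J : ideal A) f : f \in J -> - f \in J.
Proof. by rewrite rpredN. Qed.

Lemma ideal0 (A : comPzRingType) (J : ideal A) : 0 \in J.
Proof. exact: rpred0. Qed.

(** * Noetherian rings and associated primes *)

(** The maximal condition, because primes are found below as maximal members of families. Maximality
    is phrased by inclusions, since ideals are compared by membership. *)
Definition noetherian (A : comPzRingType) : Prop :=
  forall F : ideal A -> Prop, (exists J, F J) ->
  exists2 J, F J & forall K, F K -> {subset J <= K} -> {subset K <= J}.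

Lemma monomial_order_degrevlex n : monomial_order (n := n) <=%O.
Proof.
split; [exact: Order.POrderTheory.le_refl|exact: Order.POrderTheory.le_anti|
  exact: Order.POrderTheory.le_trans|exact: Order.TotalTheory.le_total|].
by split=> [m|m m1 m2 le12]; [exact: le0m|rewrite lemc_add2r].
Qed.

(* In a strictly ascending chain of ideals K_i pick f_i in K_(i+1) outside K_i
   with least leading monomial.  Dickson's lemma gives i < j such that the
   leading monomial of f_i divides that of f_j, and reducing f_j by f_i
   contradicts the choice of f_j. *)
Lemma mpoly_noetherian (k : fieldType) n : noetherian {mpoly k[n]}.
Proof.
move=> F [J0 FJ0]; apply: contrapT => nomax.
pose le : rel 'X_{1..n} := <=%O.
have le_order : monomial_order le by exact: monomial_order_degrevlex.
have step J : exists K, F J ->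
    [/\ F K, {subset J <= K} & exists2 f, f \in K & f \notin J].
  have [FJ|nFJ] := EM (F J); last by exists J.
  apply: contrapT => noK; apply: nomax; exists J => // K FK JK f fK.
  by apply: contrapT => /negP fJ; apply: noK; exists K; split=> //; exists f.
have [s sP] := choice step.
pose K i := iter i s J0.
have FK i : F (K i) by elim: i => //= i /sP[].
have KS i : {subset K i <= K i.+1} by case: (sP _ (FK i)).
have Kle i j : (i <= j)%N -> {subset K i <= K j}.
  elim: j => [|j IH]; first by rewrite leqn0 => /eqP->.
  rewrite leq_eqVlt => /predU1P[->//|/IH KiKj f /KiKj]; exact: KS.
pose new i f := f \in K i.+1 /\ f \notin K i.
have pick i : exists f, new i f /\ forall g, new i g ->
    ~ mnm_lt le (leading_mnm le g) (leading_mnm le f).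
  have [_ _ [f0 f0K f0nK]] := sP _ (FK i).
  move def_m0 : (leading_mnm le f0) => m0.
  elim/(well_founded_ind (mnm_lt_wf le_order)): m0 f0 def_m0 f0K f0nK.
  move=> m IH f def_m fK fnK.
  have [[g [[gK gnK] lt_gf]]|nolt] := EM (exists g, new i g /\
      mnm_lt le (leading_mnm le g) (leading_mnm le f)).
    by apply: (IH _ _ g (erefl _)) => //; rewrite -def_m.
  by exists f; split=> // g newg lt_gf; apply: nolt; exists g.
have [f fP] := choice pick.
have nz i : f i != 0.
  by case: (fP i) => -[_ nK] _; apply: contraNneq nK => ->; rewrite ideal0.
have [i [j [lt_ij le_ij]]] := dickson (fun i => leading_mnm le (f i)).
have [[fiK _] _] := fP i; have [[fjK fjnK] fjmin] := fP j.
have fiKj : f i \in K j by exact: Kle fiK.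
have newh : new j (lead_reduce le (f j) (f i)).
  split; first by apply: rpredB => //; apply: idealM; exact: KS.
  apply: contra fjnK => hK; rewrite -[f j](subrK (
    (f j)@_(leading_mnm le (f j)) / (f i)@_(leading_mnm le (f i)) *:
    'X_[leading_mnm le (f j) - leading_mnm le (f i)] * f i)).
  by apply: idealD => //; apply: idealM.
apply: (fjmin _ newh); apply: lead_reduce_lt => //.
by apply: contraNneq newh.2 => ->; rewrite ideal0.
Qed.

Section IdealTheory.
Variable A : comPzRingType.
Implicit Types (J K P Q : ideal A) (f g x : A).

Lemma ideal_span_sub (S : A -> Prop) J :
  (forall f, S f -> f \in J) -> {subset ideal_span S <= J}.
Proof.
move=> SJ f /asboolP[s sS ->]; rewrite big_seq; apply: rpred_sum => x xs.
by apply: idealM; apply/SJ/sS.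
Qed.

Lemma mem_ideal_span (S : A -> Prop) f : S f -> f \in ideal_span S.
Proof.
move=> Sf; apply/asboolP; exists [:: (1, f)]; last by rewrite big_seq1 mul1r.
by move=> x; rewrite inE => /eqP->.
Qed.

Lemma colon_closed J x : let p : {pred A} := fun f => f * x \in J in
  0 \in p /\ forall a, {in p &, forall u v, a * u + v \in p}.
Proof.
have pE f : (f \in ((fun f => f * x \in J) : {pred A})) = (f * x \in J).
  by [].
split=> [|a u v]; rewrite !pE; first by rewrite mul0r ideal0.
by move=> uJ vJ; rewrite mulrDl -mulrA; apply: idealD => //; apply: idealM.
Qed.
Definition colon J x : ideal A := Ideal (colon_closed J x).

Lemma mem_colon J x f : (f \in colon J x) = (f * x \in J).
Proof. by []. Qed.

Lemma adjoin_closed J x :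
  let p : {pred A} := fun f => `[< exists a, f - a * x \in J >] in
  0 \in p /\ forall a, {in p &, forall u v, a * u + v \in p}.
Proof.
split; first by apply/asboolP; exists 0; rewrite mul0r subrr ideal0.
move=> a u v /asboolP[b uJ] /asboolP[c vJ]; apply/asboolP; exists (a * b + c).
have -> : a * u + v - (a * b + c) * x = a * (u - b * x) + (v - c * x).
  by rewrite mulrDl mulrBr opprD addrACA mulrA.
by apply: idealD => //; apply: idealM.
Qed.
Definition adjoin J x : ideal A := Ideal (adjoin_closed J x).

Lemma sub_adjoin J x : {subset J <= adjoin J x}.
Proof. by move=> f fJ; apply/asboolP; exists 0; rewrite mul0r subr0. Qed.

Lemma mem_adjoin J x : x \in adjoin J x.
Proof. by apply/asboolP; exists 1; rewrite mul1r subrr ideal0. Qed.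

Lemma primeX P f i : prime_ideal P -> f ^+ i \in P -> f \in P.
Proof.
case=> P1 PM; elim: i => [|i IH]; first by rewrite expr0 (negPf P1).
by rewrite exprS => /PM[].
Qed.

Lemma primeMN P f g : prime_ideal P -> f * g \in P -> f \notin P -> g \in P.
Proof. by case=> _ PM /PM[->|]. Qed.

Lemma associated_primeP J P : associated_prime J P <->
  prime_ideal P /\ exists x, P =i colon J x.
Proof.
have zeroP f x : (cls J f * cls J x = 0) <-> f * x \in J.
  rewrite -rmorphM -(rmorph0 (cls J)); split=> [/cls_eq|fxJ].
    by rewrite subr0.
  by apply/cls_eq; rewrite subr0.
split=> -[Pp [x Px]]; split=> //.
  have [x' def_x] := clsP x; exists x' => f; rewrite def_x in Px.
  by apply/idP/idP => [/Px/zeroP|/zeroP/Px].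
by exists (cls J x) => f; rewrite Px; split=> /zeroP.
Qed.

Lemma associated_prime_sub J P : associated_prime J P -> {subset J <= P}.
Proof.
by case/associated_primeP=> _ [x Px] f fJ; rewrite Px mem_colon mulrC idealM.
Qed.

Hypothesis noetherianA : noetherian A.

(** An ideal maximal among those that contain [J] and miss the multiplicative set [T] is prime. *)
Lemma prime_ideal_avoiding J (T : A -> Prop) :
  T 1 -> (forall s t, T s -> T t -> T (s * t)) ->
  (forall t, T t -> t \notin J) ->
  exists Q, [/\ prime_ideal Q, {subset J <= Q} & forall t, T t -> t \notin Q].
Proof.
move=> T1 TM TJ; pose F K := {subset J <= K} /\ forall t, T t -> t \notin K.
have [|Q [JQ TQ] Qmax] := noetherianA (F := F); first by exists J; split.
exists Q; split=> //; split=> [|f g fgQ]; first exact: TQ.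
apply: contrapT => /not_orP[fQ gQ].
have meet h : h \notin Q -> exists2 t, T t & t \in adjoin Q h.
  move=> hQ; apply: contrapT => nomeet.
  case/negP: hQ; apply: Qmax (mem_adjoin Q h); last exact: sub_adjoin.
  split=> [u uJ|t Tt]; first exact/sub_adjoin/JQ.
  by apply/negP => tQ; apply: nomeet; exists t.
have [s Ts /asboolP[a sQ]] := meet f (introN idP fQ).
have [t Tt /asboolP[b tQ]] := meet g (introN idP gQ).
case/negP: (TQ _ (TM _ _ Ts Tt)).
(* Modulo [Q], [s] is [a * f] and [t] is [b * g], so [s * t] is a multiple of [f * g]. *)
have -> : s * t = t * (s - a * f) + a * f * (t - b * g) + a * b * (f * g).
  rewrite !mulrBr [t * s]mulrC [t * (a * f)]mulrC addrA subrK.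
  by rewrite mulrACA subrK.
by do 2?[apply: idealD]; apply: idealM.
Qed.

Lemma radical_of_primes J f :
  (forall Q, prime_ideal Q -> {subset J <= Q} -> f \in Q) -> in_radical J f.
Proof.
move=> fQ; apply: contrapT => /forallNP fJ.
have [||_ [i ->]|Q [Qp JQ fnQ]] :=
    @prime_ideal_avoiding J (fun t => exists i, t = f ^+ i).
- by exists 0%N; rewrite expr0.
- by move=> _ _ [i ->] [i' ->]; exists (i + i')%N; rewrite exprD.
- exact/negP.
by move: (fnQ f); rewrite fQ // => /(_ (ex_intro _ 1%N erefl)).
Qed.

(** A colon ideal [colon J x] maximal among those inside [Q] is prime. Being inside [Q] replaces
    being proper after localization at [Q]. *)
Lemma associated_prime_below J Q : prime_ideal Q -> {subset J <= Q} ->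
  exists2 P, associated_prime J P & {subset P <= Q}.
Proof.
move=> Qp JQ.
pose F K := exists2 x, K =i colon J x & {subset K <= Q}.
have [|P [x Px PQ] Pmax] := noetherianA (F := F).
  exists (colon J 1), 1 => // f; rewrite mem_colon mulr1; exact: JQ.
exists P => //; apply/associated_primeP; split; last by exists x.
split=> [|a b abP]; first by apply: contra Qp.1; exact: PQ.
apply: contrapT => /not_orP[/negP aP /negP bP].
(* Under these assumptions [colon J (c * x)] strictly contains [P], so by maximality it cannot stay
   inside [Q]. *)
have escape c e : c * e \in P -> e \notin P ->
    exists2 s, s \notin Q & s * c * x \in J.
  move=> ceP eP; apply: contrapT => noescape.
  case/negP: eP; have eK : e \in colon J (c * x).
    by rewrite mem_colon mulrA [e * c]mulrC -mem_colon -Px.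
  apply: Pmax eK; last first.
    by move=> f; rewrite Px !mem_colon mulrCA; exact: idealM.
  exists (c * x) => // f; rewrite mem_colon mulrA => fJ.
  by apply: contrapT => /negP fQ; apply: noescape; exists f.
have [s sQ sJ] := escape a b abP bP.
have aK : a \in colon J (s * x) by rewrite mem_colon mulrCA mulrA.
case/negP: aP; apply: Pmax aK; last first.
  by move=> f; rewrite Px !mem_colon mulrCA; exact: idealM.
exists (s * x) => // f; rewrite mem_colon mulrA -mem_colon -Px => /PQ.
by rewrite mulrC => /(primeMN Qp); apply.
Qed.

(** A maximal member among the proper ideals [colon J z] containing [colon J x] is prime;
    [z \notin J] expresses properness. *)
Lemma associated_prime_above J x : x \notin J ->
  exists2 P, associated_prime J P & {subset colon J x <= P}.
Proof.
move=> xJ; pose F K := exists2 z, K =i colon J z &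
  z \notin J /\ {subset colon J x <= K}.
have [|P [z Pz [zJ xP]] Pmax] := noetherianA (F := F).
  by exists (colon J x), x => //; split.
exists P => //; apply/associated_primeP; split; last by exists z.
split=> [|a b abP]; first by rewrite Pz mem_colon mul1r.
apply: contrapT => /not_orP[/negP aP /negP bP].
have aK : a \in colon J (b * z) by rewrite mem_colon mulrA -mem_colon -Pz.
have PK : {subset P <= colon J (b * z)}.
  by move=> f; rewrite Pz !mem_colon mulrCA; exact: idealM.
case/negP: aP; apply: Pmax aK; last exact: PK.
exists (b * z) => //; split; first by rewrite -mem_colon -Pz.
by move=> f /xP/PK.
Qed.

End IdealTheory.

(** * Krull dimension *)

Section PrimeChains.
Variable A : comPzRingType.
Implicit Types (J K P Q : ideal A).

(** By the correspondence theorem these are the chains of primes of the quotient by [J]. Seen in the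
    ring itself, chains over different ideals can be compared directly. *)
Definition prime_chain_above J (d : nat) : Prop :=
  exists2 P : nat -> ideal A,
    (forall i, (i <= d)%N -> prime_ideal (P i) /\ {subset J <= P i}) &
    forall i, (i < d)%N -> strict_subideal (P i) (P i.+1).

Lemma preim_quo_closed J (P : ideal (quo J)) :
  let p : {pred A} := fun f => cls J f \in P in
  0 \in p /\ forall a, {in p &, forall u v, a * u + v \in p}.
Proof.
have pE f : (f \in ((fun f => cls J f \in P) : {pred A})) = (cls J f \in P).
  by [].
split=> [|a u v]; rewrite !pE; first by rewrite rmorph0 ideal0.
by move=> uP vP; rewrite rmorphD rmorphM; apply: idealD => //; apply: idealM.
Qed.
Definition preim_quo J (P : ideal (quo J)) : ideal A :=
  Ideal (preim_quo_closed P).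

Lemma mem_preim_quo J (P : ideal (quo J)) f :
  (f \in preim_quo P) = (cls J f \in P).
Proof. by []. Qed.

Definition im_quo J P : ideal (quo J) :=
  ideal_span (fun x => exists2 f, f \in P & x = cls J f).

Lemma mem_im_quo J P f : {subset J <= P} ->
  (cls J f \in im_quo J P) = (f \in P).
Proof.
move=> JP; apply/idP/idP => [|fP]; last by apply: mem_ideal_span; exists f.
case/asboolP=> [s sP def_f].
suff [g gP] : exists2 g, g \in P & cls J f = cls J g.
  by move/cls_eq/JP/idealD => /(_ _ gP); rewrite subrK.
rewrite def_f; elim: s sP {def_f} => [|x s IH] sP.
  by exists 0; rewrite ?ideal0 // big_nil rmorph0.
rewrite big_cons; have [|g gP ->] := IH.
  by move=> y ys; apply: sP; rewrite inE ys orbT.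
have [h hP ->] := sP x (mem_head _ _).
have [a ->] := clsP x.1; exists (a * h + g); last by rewrite rmorphD rmorphM.
by apply: idealD => //; apply: idealM.
Qed.

Lemma prime_chain_quo J d : prime_chain (quo J) d <-> prime_chain_above J d.
Proof.
split=> -[P Pp Pstrict].
  exists (fun i => preim_quo (P i)) => [i id|i id].
    have [P1 PM] := Pp i id; split; last first.
      move=> f fJ; rewrite mem_preim_quo (_ : cls J f = 0) ?ideal0 //.
      by rewrite -(rmorph0 (cls J)); apply/cls_eq; rewrite subr0.
    split=> [|f g]; first by rewrite mem_preim_quo rmorph1.
    by rewrite !mem_preim_quo rmorphM => /PM.
  have [sub [x xP xnP]] := Pstrict i id; split=> [f|]; first exact: sub.
  by have [f def_x] := clsP x; exists f; rewrite mem_preim_quo -def_x.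
exists (fun i => im_quo J (P i)) => i id.
  have [[P1 PM] JP] := Pp i id.
  split=> [|x y]; first by rewrite -(rmorph1 (cls J)) mem_im_quo.
  have [f ->] := clsP x; have [g ->] := clsP y.
  by rewrite -rmorphM !mem_im_quo // => /PM.
have [sub [f fP fnP]] := Pstrict i id.
have [_ JPi] := Pp i (ltnW id); have [_ JPi1] := Pp _ id.
split=> [x|]; last by exists (cls J f); rewrite mem_im_quo.
by have [g ->] := clsP x; rewrite !mem_im_quo //; exact: sub.
Qed.

Lemma eq_krull_dim_quo J K : eq_krull_dim (quo J) (quo K) <->
  forall d, prime_chain_above J d <-> prime_chain_above K d.
Proof.
by split=> JK d; have := JK d;
  rewrite !(propext (prime_chain_quo _ _)).
Qed.

Lemma prime_chain_above_sub J K d : {subset J <= K} ->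
  prime_chain_above K d -> prime_chain_above J d.
Proof.
move=> JK [P Pp Pstrict]; exists P => // i /Pp[Pip KP]; split=> // f /JK; exact: KP.
Qed.

Lemma prime_chain_aboveS P Q d : prime_ideal P -> strict_subideal P Q ->
  prime_chain_above Q d -> prime_chain_above P d.+1.
Proof.
move=> Pp [PQ [x xQ xP]] [C Cp Cstrict].
exists (fun i => if i is i'.+1 then C i' else P) => [[|i] id|[|i] id].
- by split.
- have [Cip QC] := Cp i id; split=> // f /PQ; exact: QC.
- have [_ QC] := Cp 0%N (leq0n _); split; last by exists x; rewrite ?QC.
  by move=> f /PQ; exact: QC.
exact: Cstrict.
Qed.

(** If the inclusion were strict, [P] could be put in front of any chain above [Q]. Lengths
    available above [P] are available above [Q], so chains above [P] would have every length. *)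
Lemma eq_dim_primes (dmax : nat) P Q : prime_ideal P -> prime_ideal Q ->
    ~ prime_chain_above P dmax -> {subset P <= Q} ->
    (forall d, prime_chain_above P d -> prime_chain_above Q d) ->
  {subset Q <= P}.
Proof.
move=> Pp Qp noP PQ dimPQ; apply: contrapT => nQP; apply: noP.
have strict : strict_subideal P Q.
  split=> //; apply: contrapT => no; apply: nQP => f fQ.
  by apply: contrapT => /negP fP; apply: no; exists f.
elim: dmax => [|d IH]; first by exists (fun=> P) => // i _; split.
apply: (prime_chain_aboveS Pp strict); exact: dimPQ.
Qed.

End PrimeChains.

(** * Finiteness of the dimension of a polynomial ring *)

Section FiniteDimension.
Variable k : fieldType.

(** A matrix with more rows than columns has a nonzero left kernel. *)
Lemma linear_dependence (T U : finType) (M : T -> U -> k) :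
  (#|U| < #|T|)%N ->
  exists2 c : T -> k, (exists t, c t != 0) &
    forall u, \sum_t c t * M t u = 0.
Proof.
move=> lt_UT; pose N := \matrix_(i < #|T|, j < #|U|) M (enum_val i) (enum_val j).
have : kermx N != 0.
  rewrite kermx_eq0 /row_free neq_ltn (leq_ltn_trans (rank_leq_col N)) //.
case/rowV0Pn => v /sub_kermxP vN v0.
exists (fun t => v 0 (enum_rank t)).
  have /rV0Pn[i vi] := v0; exists (enum_val i); by rewrite enum_valK.
move=> u; have := congr1 (fun w : 'rV_#|U| => w 0 (enum_rank u)) vN.
rewrite !mxE => sum0; rewrite -[RHS]sum0 (reindex_onto enum_val enum_rank).
  apply: eq_big => [i|i _]; first by rewrite enum_valK eqxx.
  by rewrite mxE enum_valK enum_rankK.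
by move=> t _; rewrite enum_rankK.
Qed.

Variable n : nat.
Local Notation R := {mpoly k[n]}.

(* If all exponent vectors in S agree in the coordinates before t, then dividing
   by the least power of x_t and reducing modulo P_(t+1) kills all but the terms
   of minimal exponent at t. *)
Lemma chain_elements_independent d B (P : nat -> ideal R) (x : nat -> R)
    (c : {ffun 'I_d -> 'I_B} -> k) :
    (forall i, (i <= d)%N -> prime_ideal (P i)) ->
    (forall i, (i < d)%N ->
      [/\ {subset P i <= P i.+1}, x i \in P i.+1 & x i \notin P i]) ->
  forall t (S : {set {ffun 'I_d -> 'I_B}}), (t <= d)%N -> S != set0 ->
    {in S, forall a, c a != 0} ->
    {in S &, forall a b : {ffun 'I_d -> 'I_B},
      forall i : 'I_d, (i < t)%N -> a i = b i} ->
  \sum_(a in S) c a *: \prod_(i < d | (t <= i)%N) x i ^+ a i \notin P t.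
Proof.
move=> Pp Px t; move def_s : (d - t)%N => s.
elim: s t def_s => [|s IH] t def_s S td S0 cS agree.
  (* When no coordinate is left, [S] is a singleton and the sum is a nonzero constant, which no
     prime contains. *)
  have eq_td : t = d by apply/eqP; rewrite eqn_leq td -subn_eq0 def_s.
  subst t.
  have /set0Pn[a aS] := S0.
  have -> : S = [set a].
    apply/setP => b; rewrite inE; apply/idP/eqP => [bS|->//].
    by apply/ffunP => i; exact: agree.
  rewrite big_set1 big1 => [|i]; last by rewrite leqNgt ltn_ord.
  apply: contra (Pp d (leqnn _)).1 => /(idealM (c a)^-1%:MP).
  by rewrite mul_mpolyC scalerA mulVf ?scale1r // cS.
have {}td : (t < d)%N by rewrite -subn_gt0 def_s.
pose ti := Ordinal td.
have [a aS amin] : exists2 a, a \in S &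
    {in S, forall b : {ffun 'I_d -> 'I_B}, (a ti <= b ti)%N}.
  have /set0Pn[a0 a0S] := S0.
  case: (arg_minnP (fun a : {ffun 'I_d -> 'I_B} => a ti : nat) a0S) => a aS amin.
  by exists a.
have [PtS xtS xt] := Px t td.
pose e := nat_of_ord (a ti).
pose rest (b : {ffun 'I_d -> 'I_B}) := \prod_(i < d | (t < i)%N) x i ^+ b i.
have split b : b \in S -> \prod_(i < d | (t <= i)%N) x i ^+ b i =
    x t ^+ e * (x t ^+ (b ti - e) * rest b).
  move=> bS; rewrite (bigD1 ti) //= mulrA -exprD subnKC ?amin //; congr (_ * _).
  apply: eq_bigl => i; rewrite ltn_neqAle andbC; congr (_ && _).
  by rewrite eq_sym.
have -> : \sum_(b in S) c b *: \prod_(i < d | (t <= i)%N) x i ^+ b i =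
    x t ^+ e * \sum_(b in S) c b *: (x t ^+ (b ti - e) * rest b).
  rewrite mulr_sumr; apply: eq_bigr => b bS.
  by rewrite split // scalerAr.
apply/negP => /(primeMN (Pp t (ltnW td))) Pin.
have {}Pin : \sum_(b in S) c b *: (x t ^+ (b ti - e) * rest b) \in P t.+1.
  apply: PtS; apply: Pin; apply: contra xt; exact: (primeX (Pp t (ltnW td))).
pose S' := [set b in S | b ti == a ti].
have S'P b : b \in S' -> b \in S /\ b ti = a ti.
  by rewrite inE => /andP[bS /eqP].
suff : \sum_(b in S') c b *: rest b \in P t.+1.
  apply/negP; apply: IH => //.
  - by rewrite subnS def_s.
  - by apply/set0Pn; exists a; rewrite inE aS eqxx.
  - by move=> b /S'P[/cS].
  move=> b b' /S'P[bS bt] /S'P[b'S b't] i; rewrite ltnS leq_eqVlt.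
  case/predU1P => [it|]; last exact: agree.
  by rewrite (_ : i = ti) ?bt ?b't //; exact: val_inj.
move: Pin; rewrite (bigID (fun b : {ffun 'I_d -> 'I_B} => b ti == a ti)) /=.
set u := (X in X + _); set v := (X in _ + X); move=> uvP.
have -> : \sum_(b in S') c b *: rest b = (u + v) - v.
  rewrite addrK /u; apply: eq_big => [b|b]; first by rewrite inE.
  by case/S'P => _ ->; rewrite subnn mul1r.
apply: idealB => //; apply: rpred_sum => b /andP[bS ne].
have lt_e : (0 < b ti - e)%N.
  by rewrite subn_gt0 ltn_neqAle amin // andbT eq_sym.
rewrite -(prednK lt_e) exprS -mul_mpolyC -mulrA mulrCA.
by rewrite mulrC; apply: idealM.
Qed.

Lemma msize_prod_le (I : Type) (r : seq I) (F : I -> R) a :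
  (forall i, msize (F i) <= a.+1)%N ->
  (msize (\prod_(i <- r) F i) <= (size r * a).+1)%N.
Proof.
move=> Fa; elim: r => [|i r IH]; first by rewrite big_nil msize1.
rewrite big_cons; set p := F i; set q := \prod_(j <- r) F j.
have [->|p0] := eqVneq p 0; first by rewrite mul0r msize0.
have [->|q0] := eqVneq q 0; first by rewrite mulr0 msize0.
have := leq_add (Fa i) IH; rewrite msizeM // -/p -/q addSn addnS -mulSn.
by case: (_ + _)%N.
Qed.

Lemma msizeX_le (f : R) a b i :
  (msize f <= a.+1 -> i <= b -> msize (f ^+ i) <= (b * a).+1)%N.
Proof.
move=> fa ib; rewrite -[i]subn0 -prodr_const_nat.
have := msize_prod_le (index_iota 0 i) (fun _ : nat => fa).
by rewrite size_iota subn0 => /leq_trans; apply; rewrite ltnS leq_mul2r ib orbT.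
Qed.

(** A chain with [n.+1] strict steps yields [n.+1] elements whose monomials are linearly
    independent. There are [B ^ n.+1] monomials with exponents below [B], but they lie in a space
    whose dimension grows only like [B ^ n]. *)
Lemma mpoly_finite_dim (J : ideal R) : ~ prime_chain_above J n.+1.
Proof.
case=> P Pp Pstrict; set d := n.+1 in Pp Pstrict.
have pick i : exists x, (i < d)%N -> x \in P i.+1 /\ x \notin P i.
  have [id|di] := ltnP i d; last by exists 0.
  by have [_ [x xS xn]] := Pstrict i id; exists x.
have [x xP] := choice pick.
pose E := (\max_(i < d) msize (x i))%N.
(* With this choice [D <= B * (d * E).+1], whence [D ^ n <= B ^ n * (d * E).+1 ^ n < B ^ n.+1]. *)
pose B := ((d * E).+1 ^ n).+1.
pose D := (d * (B * E)).+1.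
pose mon (a : {ffun 'I_d -> 'I_B}) : R := \prod_(i < d) x i ^+ a i.
have mon_size a : (msize (mon a) <= D)%N.
  suff le_size (i : 'I_d) : (msize (x i ^+ a i) <= (B * E).+1)%N.
    apply: leq_trans (msize_prod_le _ le_size) _.
    by rewrite /index_enum -enumT size_enum_ord.
  apply: msizeX_le; last exact/ltnW.
  by rewrite leqW // (@leq_bigmax _ (fun i : 'I_d => msize (x i)) i).
have card_lt : (#|{: 'X_{1..n < D}}| < #|{: {ffun 'I_d -> 'I_B}}|)%N.
  have lt_D (m : 'X_{1..n < D}) i : (bmnm m i < D)%N.
    by rewrite (leq_ltn_trans _ (bmdeg m)) // mdegE (bigD1 i) // leq_addr.
  pose h (m : 'X_{1..n < D}) := [ffun i : 'I_n => Ordinal (lt_D m i)].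
  have /leq_card : injective h.
    move=> m1 m2 /ffunP eq_h; apply/val_inj/mnmP => i.
    by have := congr1 val (eq_h i); rewrite !ffunE.
  rewrite !card_ffun !card_ord => /leq_ltn_trans; apply.
  have le_D : (D <= B * (d * E).+1)%N.
    by rewrite /D mulnCA mulnS -add1n leq_add2r.
  have expn_mono u v e : (u <= v -> u ^ e <= v ^ e)%N.
    by case: e => // e; rewrite leq_exp2r.
  apply: (leq_ltn_trans (expn_mono _ _ _ le_D)).
  by rewrite expnMn expnSr ltn_pmul2l ?expn_gt0.
have [c [a0 ca0] c0] :=
  linear_dependence (fun a m => (mon a)@_(bmnm m)) card_lt.
have csum : \sum_a c a *: mon a = 0.
  apply/mpolyP => m; rewrite mcoeff0 raddf_sum /=.
  have [lt_m|le_m] := ltnP (mdeg m) D.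
    rewrite -[RHS](c0 (BMultinom lt_m)); apply: eq_bigr => a _.
    by rewrite mcoeffZ.
  rewrite big1 // => a _; rewrite mcoeffZ memN_msupp_eq0 ?mulr0 //.
  exact/msize_mdeg_ge/(leq_trans (mon_size a)).
have /negP[] : \sum_(a in [set a | c a != 0])
    c a *: \prod_(i < d | (0 <= i)%N) x i ^+ a i \notin P 0%N.
  apply: chain_elements_independent => //.
  - by move=> i /Pp[].
  - by move=> i id; have [sub _] := Pstrict i id; have [] := xP i id; split.
  - by apply/set0Pn; exists a0; rewrite inE.
  by move=> a; rewrite inE.
suff -> : \sum_(a in [set a | c a != 0]) c a *: mon a = \sum_a c a *: mon a.
  by rewrite csum ideal0.
rewrite [RHS](bigID (fun a => c a != 0)) /= [X in _ + X]big1 ?addr0.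
  by apply: eq_bigl => a; rewrite inE.
by move=> a; rewrite negbK => /eqP->; rewrite scale0r.
Qed.

End FiniteDimension.

(** * Coefficients with respect to one variable *)

Section VariableCoefficients.
Variables (k : fieldType) (n : nat) (j : 'I_n).
Local Notation R := {mpoly k[n]}.
Implicit Types (f g : R) (m : 'X_{1..n}) (J P : ideal R).

(* f as a univariate polynomial in 'X_j whose coefficients are kept in R. *)
Definition to_poly : R -> {poly R} :=
  mmap (polyC \o @mpolyC n k) (fun i => if i == j then 'X else ('X_i)%:P).

HB.instance Definition _ := GRing.RMorphism.on to_poly.

Definition ycoef (i : nat) f : R := (to_poly f)`_i.

Definition mnm_free m : 'X_{1..n} := (m - U_(j) *+ m j)%MM.

Lemma to_polyX m : to_poly 'X_[m] = ('X_[mnm_free m])%:P * 'X^(m j).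
Proof.
rewrite /to_poly mmapX /mmap1 (bigD1 j) //= eqxx mulrC; congr (_ * _).
rewrite (mpolyXE_id k (mnm_free m)) [in RHS](bigD1 j) //= /mnm_free.
rewrite mnmBE mulmnE mnm1E eqxx mul1n subnn.
rewrite expr0 mul1r rmorph_prod; apply: eq_bigr => i /negPf ij.
by rewrite ij mnmBE mulmnE mnm1E eq_sym ij mul0n subn0 rmorphXn.
Qed.

Lemma to_polyZ c f : to_poly (c *: f) = c%:MP *: to_poly f.
Proof. by rewrite /to_poly mmapZ /= mul_polyC. Qed.

Lemma ycoefD i : {morph ycoef i : f g / f + g}.
Proof. by move=> f g; rewrite /ycoef rmorphD coefD. Qed.

Lemma ycoefB i : {morph ycoef i : f g / f - g}.
Proof. by move=> f g; rewrite /ycoef rmorphB coefB. Qed.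

Lemma ycoef0 i : ycoef i 0 = 0.
Proof. by rewrite /ycoef rmorph0 coef0. Qed.

Lemma ycoefZ i c f : ycoef i (c *: f) = c *: ycoef i f.
Proof. by rewrite /ycoef to_polyZ coefZ mul_mpolyC. Qed.

Lemma ycoef_sum i (I : Type) (r : seq I) (F : I -> R) :
  ycoef i (\sum_(x <- r) F x) = \sum_(x <- r) ycoef i (F x).
Proof. by rewrite /ycoef rmorph_sum coef_sum. Qed.

Lemma mnm_freeP i m0 m :
  (mnm_free m0 == m) && (i == m0 j) = (m j == 0%N) && (m0 == m + U_(j) *+ i)%MM.
Proof.
apply/andP/andP => -[/eqP eq1 /eqP eq2]; last first.
  have m0j : m0 j = i by rewrite eq2 mnmDE eq1 mulmnE mnm1E eqxx mul1n.
  rewrite m0j eqxx; split=> //; apply/eqP/mnmP => l.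
  by rewrite /mnm_free m0j eq2 mnmBE mnmDE addnK.
have le_m0 : (U_(j) *+ m0 j <= m0)%MM.
  by apply/mnm_lepP => l; rewrite mulmnE mnm1E; case: eqP => [->|]; rewrite ?mul1n.
rewrite -{2}eq1 eq2 /mnm_free submK // eqxx; split=> //.
by rewrite -eq1 mnmBE mulmnE mnm1E eqxx mul1n subnn.
Qed.

Lemma mcoeff_ycoef i f m :
  (ycoef i f)@_m = if m j == 0%N then f@_(m + U_(j) *+ i) else 0.
Proof.
have ycoefX m0 : (ycoef i 'X_[m0])@_m =
    if m j == 0%N then ('X_[m0] : R)@_(m + U_(j) *+ i) else 0.
  rewrite /ycoef to_polyX coefCM coefXn mulr_natr mcoeffMn !mcoeffX -mulrnA mulnb.
  by rewrite mnm_freeP; case: (m j == 0%N).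
rewrite [in RHS](mpolyE f) [in LHS](mpolyE f) ycoef_sum !raddf_sum /=.
under eq_bigr do rewrite ycoefZ mcoeffZ ycoefX.
case: ifP => _; last by rewrite big1 // => m0 _; rewrite mulr0.
by apply: eq_bigr => m0 _; rewrite mcoeffZ.
Qed.

Lemma free_of_mcoeff f m : free_of j f -> m j != 0%N -> f@_m = 0.
Proof.
by move=> ff mj; apply: memN_msupp_eq0; apply: contra mj => /ff->.
Qed.

Lemma ycoef_free i f : free_of j (ycoef i f).
Proof.
by move=> m; rewrite mcoeff_msupp mcoeff_ycoef; case: ifP => [/eqP|]; rewrite ?eqxx.
Qed.

Lemma ycoef0_free f : free_of j f -> ycoef 0 f = f.
Proof.
move=> ff; apply/mpolyP => m; rewrite mcoeff_ycoef mulm0n addm0.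
by case: ifPn => // /(free_of_mcoeff ff).
Qed.

Lemma ycoefS_free i f : free_of j f -> ycoef i.+1 f = 0.
Proof.
move=> ff; apply/mpolyP => m; rewrite mcoeff_ycoef mcoeff0; case: ifP => // _.
by apply: free_of_mcoeff => //; rewrite mnmDE mulmnE mnm1E eqxx mul1n addnS.
Qed.

Lemma to_poly_free f : free_of j f -> to_poly f = f%:P.
Proof.
move=> ff; apply/polyP => -[|i]; rewrite coefC /=; first exact: ycoef0_free.
exact: ycoefS_free.
Qed.

Lemma free_of_to_poly f : to_poly f = f%:P -> free_of j f.
Proof.
by move=> ef; rewrite (_ : f = ycoef 0 f); [exact: ycoef_free|rewrite /ycoef ef coefC].
Qed.

Lemma free_of0 : free_of j (0 : R).
Proof. by apply: free_of_to_poly; rewrite rmorph0. Qed.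

Lemma free_ofD f g : free_of j f -> free_of j g -> free_of j (f + g).
Proof.
by move=> ff fg; apply: free_of_to_poly; rewrite rmorphD /= !to_poly_free // rmorphD.
Qed.

Lemma free_ofN f : free_of j f -> free_of j (- f).
Proof.
by move=> ff; apply: free_of_to_poly; rewrite rmorphN /= to_poly_free // rmorphN.
Qed.

Lemma free_ofM f g : free_of j f -> free_of j g -> free_of j (f * g).
Proof.
by move=> ff fg; apply: free_of_to_poly; rewrite rmorphM /= !to_poly_free // rmorphM.
Qed.

Lemma free_ofXn f i : free_of j f -> free_of j (f ^+ i).
Proof.
by move=> ff; apply: free_of_to_poly; rewrite rmorphXn /= !to_poly_free // rmorphXn.
Qed.

Lemma ycoef_freeM i f g : free_of j g -> ycoef i (f * g) = ycoef i f * g.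
Proof. by move=> fg; rewrite /ycoef rmorphM /= (to_poly_free fg) coefMC. Qed.

Lemma ycoefM i f g :
  ycoef i (f * g) = \sum_(l < i.+1) ycoef l f * ycoef (i - l) g.
Proof. by rewrite /ycoef rmorphM coefM. Qed.

Lemma to_polyY : to_poly 'X_j = 'X.
Proof. by rewrite /to_poly mmapX mmap1U eqxx. Qed.

Lemma ycoefXM l i f :
  ycoef i ('X_j ^+ l * f) = if (i < l)%N then 0 else ycoef (i - l) f.
Proof. by rewrite /ycoef rmorphM rmorphXn /= to_polyY coefXnM. Qed.

(** Evaluating [to_poly f] at ['X_j] returns [f]. *)
Lemma ycoef_expansion f (d : nat) : (forall i, (d <= i)%N -> ycoef i f = 0) ->
  f = \sum_(i < d) 'X_j ^+ i * ycoef i f.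
Proof.
have expand : f = (to_poly f).['X_j].
  rewrite [in LHS](mpolyE f) [in RHS](mpolyE f) rmorph_sum /= horner_sum.
  apply: eq_bigr => m _.
  rewrite to_polyZ hornerZ mul_mpolyC; congr (_ *: _).
  rewrite to_polyX hornerM hornerC hornerXn mpolyXn -mpolyXD /mnm_free submK //.
  by apply/mnm_lepP => l; rewrite mulmnE mnm1E; case: eqP => [->|]; rewrite ?mul1n.
move=> d0; rewrite {1}expand (horner_coef_wide (n := d)).
  by apply: eq_bigr => i _; rewrite mulrC.
by apply/leq_sizeP => i /d0.
Qed.

Lemma ycoef_gt_degree i f : (degree_in j f < i)%N -> ycoef i f = 0.
Proof.
move=> lt_i; apply/mpolyP => m; rewrite mcoeff0 mcoeff_ycoef; case: ifP => // _.
apply: memN_msupp_eq0; apply: contraL lt_i => fm; rewrite -leqNgt.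
have := @leq_bigmax_seq _ (msupp f) xpredT (fun m => m j) _ fm isT.
apply: leq_trans; rewrite mnmDE mulmnE mnm1E eqxx mul1n; exact: leq_addl.
Qed.

Lemma mcoeff_initial_form f m :
  (initial_form j f)@_m = if m j == degree_in j f then f@_m else 0.
Proof.
rewrite /initial_form raddf_sum /= big_mkcond /=.
case: ifPn => mj; last first.
  rewrite big1 // => m0 _; case: ifP => // m0j; rewrite mcoeffZ mcoeffX.
  by case: eqP => [eq_m|_]; [rewrite -eq_m m0j in mj|rewrite mulr0].
rewrite [in RHS](mpolyE f) raddf_sum.
apply: eq_bigr => m0 _; case: ifPn => // m0j; rewrite /= mcoeffZ mcoeffX.
by case: eqP => [eq_m|_]; [rewrite eq_m mj in m0j|rewrite mulr0].
Qed.

Lemma ycoef_initial_form i f :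
  ycoef i (initial_form j f) = if i == degree_in j f then ycoef i f else 0.
Proof.
apply/mpolyP => m; rewrite mcoeff_ycoef mcoeff_initial_form.
rewrite mnmDE mulmnE mnm1E eqxx mul1n.
case: ifP => mj; last by case: ifP; rewrite ?mcoeff0 // mcoeff_ycoef mj.
by rewrite (eqP mj) add0n; case: ifP; rewrite ?mcoeff0 // mcoeff_ycoef mj.
Qed.

(** These are the ideals generated by polynomials free of ['X_j], that is, extended from the subring
    of such polynomials. *)
Definition ycoef_closed J : Prop :=
  forall f i, f \in J -> ycoef i f \in J.

Lemma ycoef_closed_span (S : R -> Prop) :
  (forall f, S f -> free_of j f) -> ycoef_closed (ideal_span S).
Proof.
move=> Sfree f i /asboolP[s sS ->]; rewrite ycoef_sum big_seq.
apply: rpred_sum => x /sS Sx; rewrite ycoef_freeM; last exact: Sfree.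
by apply: idealM; apply: mem_ideal_span.
Qed.

Lemma coef_ideal_closed J :
  let p : {pred R} := fun f => `[< forall i, ycoef i f \in J >] in
  0 \in p /\ forall a, {in p &, forall u v, a * u + v \in p}.
Proof.
split; first by apply/asboolP => i; rewrite ycoef0 ideal0.
move=> a u v /asboolP uJ /asboolP vJ; apply/asboolP => i.
rewrite ycoefD ycoefM; apply: idealD => //.
by apply: rpred_sum => l _; apply: idealM.
Qed.
(** The contraction of [J] to the polynomials free of ['X_j], extended back to the whole ring. *)
Definition coef_ideal J : ideal R := Ideal (coef_ideal_closed J).

Lemma mem_coef_ideal J f : f \in coef_ideal J <-> forall i, ycoef i f \in J.
Proof. by split=> [/asboolP|fJ]; last exact/asboolP. Qed.

Lemma coef_ideal_sub J : {subset coef_ideal J <= J}.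
Proof.
move=> f /mem_coef_ideal fJ; rewrite (@ycoef_expansion f (degree_in j f).+1).
  by apply: rpred_sum => i _; apply: idealM.
by move=> i lt_i; apply: ycoef_gt_degree lt_i.
Qed.

(** As in Gauss's lemma: let [a] and [b] be the highest indices of coefficients of [f] and [g]
    outside [P]. In the coefficient of [f * g] at [a + b], every term except the product of these
    two lies in [P]. *)
Lemma coef_ideal_prime P : prime_ideal P -> prime_ideal (coef_ideal P).
Proof.
move=> Pp; split=> [|f g fgP]; first by apply: contra Pp.1; exact: coef_ideal_sub.
have top h : h \notin coef_ideal P -> exists i, ycoef i h \notin P /\
    forall l, (i < l)%N -> ycoef l h \in P.
  move=> hP; have ex : exists i, ycoef i h \notin P.
    apply: contrapT => /forallNP no; case/negP: hP; apply/mem_coef_ideal => i.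
    by apply: contrapT => /negP; exact: no.
  have bound i : ycoef i h \notin P -> (i <= degree_in j h)%N.
    by apply: contraR; rewrite -ltnNge => /ycoef_gt_degree->; exact: ideal0.
  case: (ex_maxnP ex bound) => i hi imax; exists i; split=> // l.
  by apply: contraLR; rewrite -leqNgt => /imax.
apply: contrapT => /not_orP[/negP/top[a [fa amax]] /negP/top[b [gb bmax]]].
have /mem_coef_ideal/(_ (a + b)%N) := fgP; rewrite ycoefM.
have lt_a : (a < (a + b).+1)%N by rewrite ltnS leq_addr.
rewrite (bigD1 (Ordinal lt_a)) //= addKn => sumP.
suff restP : \sum_(l < (a + b).+1 | l != Ordinal lt_a)
    ycoef l f * ycoef (a + b - l) g \in P.
  have := idealB sumP restP; rewrite addrK => /(primeMN Pp)/(_ fa).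
  exact/negP.
apply: rpred_sum => l; rewrite -val_eqE /= neq_ltn => /orP[la|al].
  by apply/idealM/bmax; rewrite ltn_subRL ltn_add2r.
by rewrite mulrC; apply/idealM/amax.
Qed.

End VariableCoefficients.

(** * Associated primes of unmixed ideals *)

Section Unmixed.
Variables (k : fieldType) (n : nat) (j : 'I_n).
Local Notation R := {mpoly k[n]}.
Implicit Types J P Q : ideal R.

(** An associated prime [P'] of [J] lies in [Q], hence in [P]. Both quotients have the finite
    dimension of the quotient by [J], so [P'] equals [P]. *)
Lemma unmixed_associated_minimal J P Q : unmixed J -> associated_prime J P ->
  prime_ideal Q -> {subset J <= Q} -> {subset Q <= P} -> {subset P <= Q}.
Proof.
move=> Junm JP Qp JQ QP.
have [P' JP' P'Q] := associated_prime_below (@mpoly_noetherian k n) Qp JQ.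
suff PP' : {subset P <= P'} by move=> f /PP'/P'Q.
have /eq_krull_dim_quo dimP := Junm P JP.
have /eq_krull_dim_quo dimP' := Junm P' JP'.
apply: (@eq_dim_primes _ n.+1 _ _ JP'.1 JP.1 (@mpoly_finite_dim _ _ _)).
  by move=> f /P'Q/QP.
by move=> d /dimP'/dimP.
Qed.

(** [coef_ideal j P] is a prime between [J] and [P], so minimality of [P] makes it all of [P]. *)
Lemma associated_ycoef_closed J P : unmixed J -> ycoef_closed j J ->
  associated_prime J P -> ycoef_closed j P.
Proof.
move=> Junm Jcl JP f i fP.
suff /(_ f fP)/mem_coef_ideal : {subset P <= coef_ideal j P} by apply.
apply: (unmixed_associated_minimal Junm JP (coef_ideal_prime j JP.1) _
  (@coef_ideal_sub _ _ j P)).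
by move=> g gJ; apply/mem_coef_ideal => l; apply: (associated_prime_sub JP); exact: Jcl.
Qed.

(** Since [P] is minimal over [J], it becomes nil modulo [J] after localization at [P]: a prime over
    [J] avoiding all [s * f ^+ i] would lie in [P] without containing [f]. *)
Lemma associated_nilpotent J P f : unmixed J -> associated_prime J P -> f \in P ->
  exists s i, s \notin P /\ s * f ^+ i \in J.
Proof.
move=> Junm JP fP; apply: contrapT => no.
pose T t := exists s i, s \notin P /\ t = s * f ^+ i.
have Pp := JP.1; have P1 : 1 \notin P by case: Pp.
have [||t [s [i [sP ->]]]|Q [Qp JQ TQ]] :=
    @prime_ideal_avoiding _ (@mpoly_noetherian k n) J T.
- by exists 1, 0%N; rewrite mul1r.
- move=> _ _ [s [i [sP ->]]] [s' [i' [s'P ->]]]; exists (s * s'), (i + i')%N.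
  split; last by rewrite exprD mulrACA.
  by apply/negP => /(primeMN Pp)/(_ sP); exact/negP.
- by apply/negP => sJ; apply: no; exists s, i.
have fQ : f \in Q.
  apply: (unmixed_associated_minimal Junm JP Qp JQ _ fP) => g.
  apply: contraLR => gP; have := TQ g; apply; exists g, 0%N.
  by rewrite mulr1.
have Tf : T f by exists 1, 1%N; rewrite mul1r.
by have := TQ f Tf; rewrite fQ.
Qed.

End Unmixed.

(** * Linear generators of [I] and the associated primes of [N] *)

Section Decomposition.
Variables (k : fieldType) (n : nat) (j : 'I_n).
Local Notation R := {mpoly k[n]}.
Variables I C N : ideal R.
Implicit Types J P Q : ideal R.

(** The elements of [I] of degree at most one in ['X_j], recorded by their coefficients; [c = 0] is
    allowed and gives those free of ['X_j]. *)
Definition linear_element (c r : R) : Prop :=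
  [/\ free_of j c, free_of j r & 'X_j * c + r \in I].

Hypothesis C_closed : ycoef_closed j C.
Hypothesis N_closed : ycoef_closed j N.
Hypothesis sub_NI : {subset N <= I}.
Hypothesis sub_NC : {subset N <= C}.
Hypothesis elimination : forall f, f \in I -> free_of j f -> f \in N.
Hypothesis top_coef : forall i f, f \in I ->
  (forall l, (i < l)%N -> ycoef j l f = 0) -> ycoef j i f \in C.
Hypothesis linear_lift : forall c, c \in C -> free_of j c ->
  exists r, linear_element c r.

Lemma ycoef_linear (c r : R) i : free_of j c -> free_of j r ->
  ycoef j i ('X_j * c + r) = match i with 0%N => r | 1%N => c | _ => 0 end.
Proof.
move=> fc fr; rewrite ycoefD -[X in X * c]expr1 ycoefXM.
case: i => [|[|i]] /=; first by rewrite add0r ycoef0_free.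
  by rewrite subnn ycoef0_free // ycoefS_free // addr0.
by rewrite subn1 /= !ycoefS_free // addr0.
Qed.

Lemma linear_element_C c r : linear_element c r -> c \in C.
Proof.
case=> fc fr gI; have <- : ycoef j 1 ('X_j * c + r) = c by rewrite ycoef_linear.
by apply: top_coef => // -[|[|l]] // _; rewrite ycoef_linear.
Qed.

(** The terms in ['X_j] cancel in the cross combination of the two elements, which stays in [I];
    elimination puts it in [N]. *)
Lemma linear_syzygy c r c' r' : linear_element c r -> linear_element c' r' ->
  c * r' - c' * r \in N.
Proof.
move=> [fc fr gI] [fc' fr' gI']; apply: elimination.
  have -> : c * r' - c' * r = c * ('X_j * c' + r') - c' * ('X_j * c + r).
    by rewrite !mulrDr opprD addrACA mulrCA [c' * ('X_j * _)]mulrCA [c' * c]mulrC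
      subrr add0r.
  by apply: idealB; apply: idealM.
by apply: free_ofD; [|apply: free_ofN]; apply: free_ofM.
Qed.

(* Since the top coefficient c of f lies in C, subtracting a multiple of
   'X_j * c + r lowers the degree in 'X_j as long as it is at least 1. *)
Lemma linear_elements_generate (Pr : R -> Prop) :
    (forall c r, linear_element c r -> Pr ('X_j * c + r)) ->
    (forall a f g, Pr f -> Pr g -> Pr (a * f + g)) ->
  forall f, f \in I -> Pr f.
Proof.
move=> Plin Pcomb f fI.
suff ind d : forall f, f \in I -> (forall l, (d < l)%N -> ycoef j l f = 0) -> Pr f.
  by apply: (ind (degree_in j f)) => // l; exact: ycoef_gt_degree.
elim: d {f fI} => [|d IH] f fI f0.
  have def_f : f = 'X_j * 0 + ycoef j 0 f.
    by rewrite mulr0 add0r {1}(ycoef_expansion (d := 1) f0) big_ord1 mul1r.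
  rewrite def_f; apply: Plin; split; [exact: free_of0|exact: ycoef_free|].
  by rewrite -def_f.
have [r lin] := linear_lift (top_coef fI f0) (@ycoef_free _ _ j d.+1 f).
have [fc fr gI] := lin; set g := 'X_j * _ + r in gI.
rewrite (_ : f = 'X_j ^+ d * g + (f - 'X_j ^+ d * g)); last by rewrite addrC subrK.
apply: Pcomb; first exact: Plin.
apply: IH => [|l lt_l]; first by apply: idealB => //; apply: idealM.
rewrite ycoefB ycoefXM ltnNge (ltnW lt_l) /= ycoef_linear //.
move: lt_l; rewrite leq_eqVlt => /predU1P[<-|lt_l]; first by rewrite subSnn subrr.
rewrite f0 //; have : (1 < l - d)%N by rewrite ltn_subRL addn1.
by case: (l - d)%N => [|[|]] //; rewrite subr0.
Qed.

Hypothesis I_unmixed : unmixed I.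
Hypothesis N_unmixed : unmixed N.
Hypothesis nondegenerate : ~ degenerate C N.

Lemma linear_element_mem Q : ycoef_closed j Q -> {subset I <= Q} ->
  forall c r, linear_element c r -> c \in Q.
Proof.
move=> Qcl IQ c r [fc fr /IQ gQ].
by have := Qcl _ 1%N gQ; rewrite ycoef_linear.
Qed.

Lemma sub_C_free J : (forall c, c \in C -> free_of j c -> c \in J) ->
  {subset C <= J}.
Proof.
move=> CJ c cC; rewrite (@ycoef_expansion _ _ j c (degree_in j c).+1).
  apply: rpred_sum => i _; apply: idealM; apply: CJ; first exact: C_closed.
  exact: ycoef_free.
by move=> i lt_i; apply: ycoef_gt_degree lt_i.
Qed.

(** Each [c] in [C] free of ['X_j] is a coefficient of an element of [I], and [Q] contains the
    coefficients of its elements. *)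
Lemma sub_I_sub_C Q : ycoef_closed j Q -> {subset I <= Q} -> {subset C <= Q}.
Proof.
move=> Qcl IQ; apply: sub_C_free => c cC /(linear_lift cC)[r].
exact: linear_element_mem.
Qed.

(* If C lies in P then so does I: modulo N and localized at P, the elements of
   C are nilpotent, so some power of r lies, up to a factor outside P, in the
   elimination ideal of I, i.e. in N. *)
Lemma sub_C_sub_I P : associated_prime N P -> {subset C <= P} -> {subset I <= P}.
Proof.
move=> NP CP; apply: linear_elements_generate => [c r lin|a f g fP gP]; last first.
  by apply: idealD => //; apply: idealM.
have cP := CP _ (linear_element_C lin); have [fc fr gI] := lin.
apply: idealD; first exact: idealM.
have [s0 [i [s0P s0N]]] := associated_nilpotent N_unmixed NP cP.
(* Some coefficient of [s0] lies outside [P], since otherwise [s0] would be in [P]. It can replace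
   [s0] because [c ^+ i] is free of ['X_j] and [N] is closed under coefficients. *)
have [s [fs sP sN]] : exists s, [/\ free_of j s, s \notin P & s * c ^+ i \in N].
  apply: contrapT => no; case/negP: s0P; apply: (@coef_ideal_sub _ _ j).
  apply/mem_coef_ideal => l; apply: contrapT => /negP lP; apply: no.
  exists (ycoef j l s0); split=> //; first exact: ycoef_free.
  by rewrite -ycoef_freeM; [exact: N_closed|exact: free_ofXn].
have : s * r ^+ i \in P.
  apply: (associated_prime_sub NP); apply: elimination; last first.
    by apply: free_ofM => //; exact: free_ofXn.
  (* Modulo [I], [r] is [- ('X_j * c)], so their powers agree; what remains is a multiple of
     [s * c ^+ i]. *)
  have -> : s * r ^+ i = s * (r ^+ i - (- ('X_j * c)) ^+ i) +
      (- 'X_j) ^+ i * (s * c ^+ i).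
    by rewrite mulrCA -exprMn mulNr -mulrDr subrK.
  apply: idealD; last by apply/idealM/sub_NI.
  by rewrite subrXX opprK [r + _]addrC mulrCA mulrC; exact: idealM.
by move/(primeMN NP.1)/(_ sP); exact: primeX NP.1.
Qed.

(* Otherwise P is minimal over I, so R/I and R/N have the same dimension and
   every associated prime of I is one of N; these contain C, whence C lies in
   the radical of N. *)
Lemma not_sub_C P : associated_prime N P -> ~ {subset C <= P}.
Proof.
move=> NP CP; have IP := sub_C_sub_I NP CP.
have noeth := @mpoly_noetherian k n.
have [P' IP' P'P] := associated_prime_below noeth NP.1 IP.
have PP' : {subset P <= P'}.
  apply: (unmixed_associated_minimal N_unmixed NP IP'.1 _ P'P).
  by move=> f /sub_NI; apply: associated_prime_sub.
have dim d : prime_chain_above I d <-> prime_chain_above N d.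
  have /eq_krull_dim_quo/(_ d) dimI := I_unmixed IP'.
  have /eq_krull_dim_quo/(_ d) dimN := N_unmixed NP.
  split=> [/dimI ch|/dimN ch].
    by apply/dimN; apply: prime_chain_above_sub PP' ch.
  by apply/dimI; apply: prime_chain_above_sub P'P ch.
have C_in Q : associated_prime I Q -> {subset C <= Q}.
  move=> IQ; have NQ f : f \in N -> f \in Q.
    by move/sub_NI; apply: associated_prime_sub.
  have [Q' NQ' Q'Q] := associated_prime_below noeth IQ.1 NQ.
  have QQ' : {subset Q <= Q'}.
    have /eq_krull_dim_quo dimI := I_unmixed IQ.
    have /eq_krull_dim_quo dimN := N_unmixed NQ'.
    apply: (@eq_dim_primes _ n.+1 _ _ NQ'.1 IQ.1 (@mpoly_finite_dim _ _ _) Q'Q).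
    by move=> d /dimN/dim/dimI.
  suff CQ' : {subset C <= Q'} by move=> c /CQ'/Q'Q.
  apply: sub_I_sub_C; first exact: associated_ycoef_closed N_unmixed N_closed NQ'.
  by move=> f /(associated_prime_sub IQ)/QQ'.
apply: nondegenerate; left.
(* Inside each prime over [N] only elements [c] of [C] free of ['X_j] need checking. Such a [c] lies
   in every prime over [I], so a power of it is in [I] and, being free of ['X_j], in [N]. *)
have radC f : f \in C -> in_radical N f.
  move=> fC; apply: (radical_of_primes noeth) => Q Qp NQ.
  move: f fC; apply: sub_C_free => c cC fc.
  have [|i ciI] := @radical_of_primes _ noeth I c.
    move=> Q' Q'p IQ'; have [Q'' IQ'' Q''Q'] := associated_prime_below noeth Q'p IQ'.
    exact/Q''Q'/(C_in _ IQ'').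
  by apply: (primeX (i := i) Qp); apply/NQ/elimination/free_ofXn.
move=> f; split=> [[i /radC[l]]|[i /sub_NC fi]]; last by exists i.
by rewrite -exprM; exists (i * l)%N.
Qed.

Lemma not_sub_I P : associated_prime N P -> ~ {subset I <= P}.
Proof.
move=> NP IP; apply: (not_sub_C NP); apply: sub_I_sub_C IP.
exact: associated_ycoef_closed N_unmixed N_closed NP.
Qed.

(** If [x] were not in [N], some associated prime of [N] would contain [colon N x], hence [J]. *)
Lemma colon_not_sub J x : (forall P, associated_prime N P -> ~ {subset J <= P}) ->
  (forall f, f \in J -> f * x \in N) -> x \in N.
Proof.
move=> nosub JN; apply: contrapT => /negP xN.
have [P NP xP] := associated_prime_above (@mpoly_noetherian k n) xN.
by apply: (nosub P NP) => f fJ; apply: xP; exact: JN.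
Qed.

End Decomposition.

(** * Groebner bases for orders compatible with a variable *)

Section GroebnerBasis.
Variables (k : fieldType) (n : nat) (j : 'I_n).
Local Notation R := {mpoly k[n]}.

Lemma initial_term0 le : initial_term le (0 : R) = 0.
Proof. by rewrite /initial_term mcoeff0 scale0r. Qed.

Lemma mnm_free_decomp (m : 'X_{1..n}) :
  mnm_free j m j = 0%N /\ (mnm_free j m + U_(j) *+ m j)%MM = m.
Proof.
have /esym := mnm_freeP j (m j) m (mnm_free j m); rewrite !eqxx /=.
by case/andP=> /eqP-> /eqP.
Qed.

Lemma ycoef_supp (f : R) m : m \in msupp f -> ycoef j (m j) f != 0.
Proof.
rewrite mcoeff_msupp; apply: contraNneq => f0.
have [m0 def_m] := mnm_free_decomp m.
by have := mcoeff_ycoef j (m j) f (mnm_free j m);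
  rewrite m0 eqxx def_m f0 mcoeff0 => <-.
Qed.

Lemma ycoef_mulX (m : 'X_{1..n}) (f : R) i : (m j <= i)%N ->
  ycoef j i ('X_[m] * f) = 'X_[mnm_free j m] * ycoef j (i - m j) f.
Proof.
move=> le_i; rewrite /ycoef rmorphM /= to_polyX -mulrA coefCM coefXnM.
by rewrite ltnNge le_i.
Qed.

Variables (le : rel 'X_{1..n}).
Hypothesis le_order : monomial_order le.
Hypothesis le_compatible : compatible k j le.

(** By compatibility the leading monomial of [f] is that of its initial form, all of whose monomials
    have the full degree in ['X_j]. *)
Lemma leading_mnm_degree (f : R) : f != 0 ->
  initial_form j f != 0 /\ leading_mnm le f j = degree_in j f.
Proof.
move=> f0; have := le_compatible f; set h := initial_form j f => eq_in.
have fm0 := leading_coeff_neq0 le_order f0.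
have h0 : h != 0.
  apply: contraNneq fm0 => h0; move: eq_in; rewrite h0 initial_term0 => in0.
  have := congr1 (mcoeff (leading_mnm le f)) in0.
  by rewrite /initial_term mcoeffZ mcoeffX eqxx mulr1 mcoeff0 => ->.
split=> //; have [+ _] := leading_mnmP le_order h0.
rewrite mcoeff_msupp => hm0.
have -> : leading_mnm le f = leading_mnm le h.
  have := congr1 (mcoeff (leading_mnm le h)) eq_in; rewrite /initial_term.
  rewrite !mcoeffZ !mcoeffX eqxx mulr1; case: eqP => // _; rewrite mulr0 => h0'.
  by rewrite -h0' eqxx in hm0.
by move: hm0; rewrite mcoeff_initial_form; case: ifP => [/eqP//|]; rewrite eqxx.
Qed.

(** In a combination of terms, the coefficient at the leading monomial of [f] vanishes unless one of
    their monomials divides it. *)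
Lemma initial_ideal_dvd (I : finType) (g : I -> R) (f : R) : f != 0 ->
    initial_term le f \in ideal_span (fun h => exists i, h = initial_term le (g i)) ->
  exists i, (leading_mnm le (g i) <= leading_mnm le f)%MM.
Proof.
move=> f0 /asboolP[s sS in_f]; apply: contrapT => /forallNP nodvd.
case/negP: (leading_coeff_neq0 le_order f0).
have := congr1 (mcoeff (leading_mnm le f)) in_f.
rewrite {1}/initial_term mcoeffZ mcoeffX eqxx mulr1 => ->.
rewrite raddf_sum big_seq big1 // => x /sS[i ->] /=.
rewrite /initial_term -scalerAr mcoeffZ; set m := leading_mnm le (g i).
suff /memN_msupp_eq0-> : leading_mnm le f \notin msupp (x.1 * 'X_[m]).
  by rewrite mulr0.
rewrite (perm_mem (msuppMX _ _)); apply/negP => /mapP[m' _ def_m].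
by apply: (nodvd i); rewrite def_m lem_addr.
Qed.

Variables (I : ideal R) (p : nat) (d : 'I_p -> nat) (q r : 'I_p -> R).
Hypothesis basis : y_groebner_basis le j I d q r.

Let g i := 'X_j ^+ d i * q i + r i.

Lemma groebner_element i :
  [/\ free_of j (q i), g i \in I, g i != 0, degree_in j (g i) = d i &
      ycoef j (d i) (g i) = q i].
Proof.
have [qfree init gI _] := basis; have [giI gi0] := gI i.
have [in0 _] := leading_mnm_degree gi0.
have in_coef l := ycoef_initial_form j l (g i).
have in_d : ycoef j (d i) (initial_form j (g i)) = q i.
  by rewrite init ycoefXM ltnn subnn ycoef0_free.
suff deg : degree_in j (g i) = d i.
  split; [exact: qfree|exact: giI|exact: gi0|exact: deg|].
  by have := in_coef (d i); rewrite in_d deg eqxx => ->.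
apply/eqP; apply: contraNT in0 => ne; have := in_coef (d i).
by rewrite in_d eq_sym (negPf ne) init => ->; rewrite mulr0.
Qed.

Lemma groebner_ycoef i l : (d i <= l)%N ->
  ycoef j l (g i) = if l == d i then q i else 0.
Proof.
have [_ _ _ deg top] := groebner_element i.
rewrite leq_eqVlt => /predU1P[<-|lt_l]; first by rewrite eqxx.
by rewrite gtn_eqF // ycoef_gt_degree ?deg.
Qed.

(** Induction on the leading monomial: reducing [f] by a basis element changes its coefficient at
    [D] by a multiple of some [q i] with [d i <= D]. [D] is only a bound on the degree, since a
    reduction may lower the degree. *)
Lemma groebner_top_coef D f : f \in I -> (forall l, (D < l)%N -> ycoef j l f = 0) ->
  ycoef j D f \in ideal_span (fun h => exists2 i, (d i <= D)%N & h = q i).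
Proof.
have [_ _ _ in_I] := basis; set J := ideal_span _.
move def_m : (leading_mnm le f) => m.
elim/(well_founded_ind (mnm_lt_wf le_order)): m f def_m => m IH f def_m fI fD.
have [->|f0] := eqVneq f 0; first by rewrite ycoef0 ideal0.
have [|i dvd_i] := initial_ideal_dvd (g := g) f0.
  by rewrite -in_I; apply: mem_ideal_span; exists f.
have [_ giI gi0 deg top] := groebner_element i.
pose h := lead_reduce le f (g i).
pose a := (leading_mnm le f - leading_mnm le (g i))%MM.
pose c := f@_(leading_mnm le f) / (g i)@_(leading_mnm le (g i)).
have hE : h = f - c *: ('X_[a] * g i) by rewrite /h /lead_reduce scalerAl.
have lm_f : (leading_mnm le f j <= D)%N.
  have [/ycoef_supp + _] := leading_mnmP le_order f0.
  by apply: contraNleq => /fD->.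
have aj : a j = (leading_mnm le f j - d i)%N.
  by rewrite /a mnmBE (leading_mnm_degree gi0).2 deg.
have di : (d i <= leading_mnm le f j)%N.
  by rewrite -deg -(leading_mnm_degree gi0).2; apply/mnm_lepP.
(* As [a j + d i] is the degree of [f] in ['X_j], at most [D], only the top coefficient of [g i] can
   contribute from [D] on. *)
have ycoef_h l : (D <= l)%N -> ycoef j l h = ycoef j l f -
    c *: ('X_[mnm_free j a] * if (l - a j == d i)%N then q i else 0).
  move=> le_l; rewrite hE ycoefB ycoefZ ycoef_mulX; last first.
    by rewrite aj (leq_trans (leq_subr _ _)) // (leq_trans lm_f).
  rewrite groebner_ycoef // aj leq_subRL; last first.
    by rewrite (leq_trans (leq_subr _ _)) // (leq_trans lm_f).
  by rewrite subnK // (leq_trans lm_f).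
have hI : h \in I.
  by rewrite hE -mul_mpolyC; apply: idealB => //; do 2!apply: idealM.
have hD l : (D < l)%N -> ycoef j l h = 0.
  move=> lt_l; rewrite ycoef_h; last exact: ltnW.
  rewrite fD // gtn_eqF ?mulr0 ?scaler0 ?subrr //.
  by rewrite aj ltn_subRL subnK // (leq_ltn_trans lm_f).
have -> : ycoef j D f = ycoef j D h +
    (c%:MP * 'X_[mnm_free j a]) * (if (D - a j == d i)%N then q i else 0).
  by rewrite ycoef_h // -mulrA mul_mpolyC subrK.
apply: idealD; last first.
  case: ifP => _; last by rewrite mulr0 ideal0.
  apply/idealM/mem_ideal_span; exists i => //; exact: leq_trans lm_f.
have [->|h0] := eqVneq h 0; first by rewrite ycoef0 ideal0.
apply: (IH (leading_mnm le h)) => //.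
by rewrite -def_m; exact: lead_reduce_lt.
Qed.

(** This is the previous result for [D = 0], where only the [q i] with [d i = 0] occur. *)
Lemma groebner_elimination f : f \in I -> free_of j f -> f \in N_ideal d q.
Proof.
move=> fI ff; rewrite -(ycoef0_free ff).
apply: (ideal_span_sub _ (groebner_top_coef fI _)) => [_ [i di ->]|[|l] // _].
  by apply: mem_ideal_span; exists i => //; apply/eqP; rewrite -leqn0.
exact: ycoefS_free.
Qed.

Lemma groebner_top_coef_C D f : f \in I -> (forall l, (D < l)%N -> ycoef j l f = 0) ->
  ycoef j D f \in C_ideal q.
Proof.
move=> fI fD; apply: (ideal_span_sub _ (groebner_top_coef fI fD)) => _ [i _ ->].
by apply: mem_ideal_span; exists i.
Qed.

Lemma N_ideal_sub_C : {subset N_ideal d q <= C_ideal q}.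
Proof.
by apply: ideal_span_sub => _ [i _ ->]; apply: mem_ideal_span; exists i.
Qed.

Lemma N_ideal_sub_I : {subset N_ideal d q <= I}.
Proof.
apply: ideal_span_sub => _ [i di ->].
have [_ giI _ deg top] := groebner_element i.
suff -> : q i = g i by [].
rewrite -top di [RHS](@ycoef_expansion _ _ j _ 1) ?big_ord1 ?mul1r // => l l0.
by apply: ycoef_gt_degree; rewrite deg di.
Qed.

Lemma C_ideal_closed : ycoef_closed j (C_ideal q).
Proof. by apply: ycoef_closed_span => _ [i ->]; case: (groebner_element i). Qed.

Lemma N_ideal_closed : ycoef_closed j (N_ideal d q).
Proof. by apply: ycoef_closed_span => _ [i _ ->]; case: (groebner_element i). Qed.

End GroebnerBasis.

(* Read off the coefficient of 'X_j in an expression of 'X_j * c as a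
   combination of initial forms of elements of I: only the f in I of degree at
   most 1 contribute. *)
Lemma gvd_linear_lift (k : fieldType) n (j : 'I_n) (I C N : ideal {mpoly k[n]}) c :
    geometric_vertex_decomposition j I C N -> c \in C -> free_of j c ->
  exists r, linear_element j I c r.
Proof.
move=> gvd cC fc.
have : 'X_j * c \in initial_form_ideal j I.
  have XN : 'X_j * c \in ideal_add N (ideal_span (fun f => f = 'X_j)).
    rewrite mulrC; apply: idealM; apply: mem_ideal_span; right.
    exact: mem_ideal_span.
  by rewrite gvd inE /= idealM //; exact: XN.
case/asboolP=> s sS def_c.
have {def_c} -> : c = \sum_(x <- s) ycoef j 1 (x.1 * x.2).
  by rewrite -ycoef_sum -def_c -['X_j]expr1 ycoefXM /= subnn ycoef0_free.
rewrite big_seq; elim/big_ind: _ => [|c1 c2 [r1 lin1] [r2 lin2]|x xs].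
- exists 0; split; [exact: free_of0|exact: free_of0|].
  by rewrite mulr0 addr0 ideal0.
- have [[fc1 fr1 g1] [fc2 fr2 g2]] := (lin1, lin2); exists (r1 + r2).
  split; [exact: free_ofD|exact: free_ofD|].
  by rewrite mulrDr addrACA idealD.
have [f fI ->] := sS x xs.
rewrite ycoefM !big_ord_recr big_ord0 /= subn0 subnn add0r !ycoef_initial_form.
set a0 := ycoef j 0 x.1; set a1 := ycoef j 1 x.1.
have fa0 : free_of j a0 by exact: ycoef_free.
have fa1 : free_of j a1 by exact: ycoef_free.
(* In degree 0 the contribution comes from ['X_j * (a1 * f)], in degree 1 from [a0 * f]; from degree
   2 on there is none. *)
case def_d : (degree_in j f) => [|[|d]] /=.
- have ff : free_of j f.
    rewrite (@ycoef_expansion _ _ j f 1) ?big_ord1 ?mul1r; first exact: ycoef_free.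
    by move=> l l0; apply: ycoef_gt_degree; rewrite def_d.
  rewrite mulr0 add0r ycoef0_free //; exists 0.
  split; [exact: free_ofM|exact: free_of0|].
  by rewrite addr0 mulrA; exact: idealM.
- rewrite mulr0 addr0; exists (a0 * ycoef j 0 f).
  split; [exact/free_ofM/ycoef_free|exact/free_ofM/ycoef_free|].
  have -> : 'X_j * (a0 * ycoef j 1 f) + a0 * ycoef j 0 f = a0 * f.
    rewrite [f in RHS](@ycoef_expansion _ _ j f 2); last first.
      by move=> l l1; apply: ycoef_gt_degree; rewrite def_d.
    by rewrite !big_ord_recl big_ord0 /= expr0 mul1r addr0 mulrDr addrC mulrCA.
  exact: idealM.
rewrite !mulr0 addr0; exists 0; split; [exact: free_of0|exact: free_of0|].
by rewrite mulr0 addr0 ideal0.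
Qed.

(** * The isomorphism and its grading *)

Section RelationIsomorphism.
Variables (A : comPzRingType) (K K' N : ideal A) (W : A -> A -> Prop).

Hypothesis W_linear : forall a f g c e, W f c -> W g e -> W (a * f + g) (a * c + e).
Hypothesis W_total : forall f, f \in K -> exists2 c, c \in K' & W f c.
Hypothesis W_surj : forall c, c \in K' -> exists2 f, f \in K & W f c.
Hypothesis W_N : forall f c, f \in K -> c \in K' -> W f c -> f \in N <-> c \in N.

Lemma quo_mod_rep (J : ideal A) (x : quo_mod J N) :
  exists2 f, f \in J & val x = cls N f.
Proof. by case: x => x /= /asboolP. Qed.

Lemma quo_mod_mk (J : ideal A) f : f \in J -> exists x : quo_mod J N, val x = cls N f.
Proof.
move=> fJ; have xP : cls N f \in quo_sub_pred J (N := N).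
  by apply/asboolP; exists f.
by exists (exist _ (cls N f) xP).
Qed.

Lemma val_quo_modP (J : ideal A) a (x y : quo_mod J N) :
  val (a *: x + y) = a * (val x : quo N) + val y.
Proof. by []. Qed.

Lemma relation_congr f g c e : f \in K -> g \in K -> c \in K' -> e \in K' ->
  W f c -> W g e -> cls N f = cls N g <-> cls N c = cls N e.
Proof.
move=> fK gK cK eK Wfc Wge; rewrite !cls_eq.
have Wd := W_linear (-1) Wge Wfc; rewrite !mulN1r ![- _ + _]addrC in Wd.
by apply: W_N Wd; apply: idealB.
Qed.

(** A relation replaces a map because [f] determines [c] only modulo [N]. The two directions of
    [W_N] make the induced map well defined and injective. The last clause, by which any related
    pair computes [phi], serves the grading. *)
Lemma relation_isomorphism : exists phi : {linear quo_mod K N -> quo_mod K' N},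
  bijective phi /\
  forall f c x, f \in K -> c \in K' -> W f c -> val x = cls N f ->
    val (phi x) = cls N c.
Proof.
have ex (x : quo_mod K N) : exists y : quo_mod K' N, exists f c,
    [/\ f \in K, c \in K', W f c, val x = cls N f & val y = cls N c].
  have [f fK xf] := quo_mod_rep x; have [c cK Wfc] := W_total fK.
  by have [y yc] := quo_mod_mk cK; exists y, f, c.
have [phi0 phi0P] := choice ex.
have phi0_val f c x : f \in K -> c \in K' -> W f c -> val x = cls N f ->
    val (phi0 x) = cls N c.
  move=> fK cK Wfc xf; have [g [e [gK eK Wge xg ->]]] := phi0P x.
  apply/(relation_congr gK fK eK cK Wge Wfc).
  by rewrite -xg.
have phi0_linear : linear phi0.
  move=> a x y; apply: val_inj.
  have [f [c [fK cK Wfc xf xc]]] := phi0P x.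
  have [g [e [gK eK Wge yg ye]]] := phi0P y.
  have [b def_a] := clsP a.
  rewrite (@phi0_val (b * f + g) (b * c + e)).
  - by rewrite val_quo_modP xc ye def_a rmorphD rmorphM.
  - by apply: idealD => //; apply: idealM.
  - by apply: idealD => //; apply: idealM.
  - exact: W_linear.
  by rewrite val_quo_modP xf yg def_a rmorphD rmorphM.
have phi0_inj : injective phi0.
  move=> x y eq_xy; apply: val_inj.
  have [f [c [fK cK Wfc xf xc]]] := phi0P x.
  have [g [e [gK eK Wge yg ye]]] := phi0P y.
  rewrite xf yg; apply/(relation_congr fK gK cK eK Wfc Wge).
  by rewrite -xc -ye eq_xy.
have phi0_surj (y : quo_mod K' N) : exists x, phi0 x = y.
  have [c cK yc] := quo_mod_rep y.
  have [f fK Wfc] := W_surj cK; have [x xf] := quo_mod_mk fK; exists x.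
  by apply: val_inj; rewrite yc; exact: phi0_val xf.
have [psi psiP] := choice phi0_surj.
pose phi0_lin := GRing.isLinear.Build _ _ _ _ phi0 phi0_linear.
pose phi : {linear quo_mod K N -> quo_mod K' N} := HB.pack phi0 phi0_lin.
exists phi; split; last exact: phi0_val.
exists psi => // x; exact/phi0_inj/psiP.
Qed.

End RelationIsomorphism.

(** * Homogeneous components of polynomials and ideals *)

Section HomogeneousComponents.
Variables (k : fieldType) (n : nat).
Local Notation R := {mpoly k[n]}.
Implicit Types (f g h : R) (J : ideal R).

Lemma mcoeff_pihomog e f m :
  (pihomog mdeg e f)@_m = if mdeg m == e then f@_m else 0.
Proof.
rewrite pihomogE raddf_sum /= big_mkcond /=.
case: ifPn => me; last first.
  rewrite big1 // => m0 _; case: ifP => // m0e; rewrite mcoeffZ mcoeffX.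
  by case: eqP => [eq_m|_]; [rewrite -eq_m m0e in me|rewrite mulr0].
rewrite [in RHS](mpolyE f) raddf_sum.
apply: eq_bigr => m0 _; case: ifPn => // m0e; rewrite /= mcoeffZ mcoeffX.
by case: eqP => [eq_m|_]; [rewrite eq_m me in m0e|rewrite mulr0].
Qed.

Lemma pihomog_sum f d : (msize f <= d)%N -> f = \sum_(i < d) pihomog mdeg i f.
Proof. exact: pihomog_partitionE. Qed.

Lemma pihomogMr e d f h : h \is d.-homog ->
  pihomog mdeg e (f * h) = if (d <= e)%N then pihomog mdeg (e - d) f * h else 0.
Proof.
(* [K] exceeds [e] as well, so that the only surviving index [e - d] is in the range of the sum. *)
move=> hh; pose K := maxn (msize f) e.+1.
rewrite {1}(@pihomog_sum f K) ?leq_maxl // mulr_suml raddf_sum /=.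
have comp i : pihomog mdeg e (pihomog mdeg i f * h) =
    if (i + d == e)%N then pihomog mdeg i f * h else 0.
  have fh : pihomog mdeg i f * h \is (i + d).-homog.
    by apply: dhomogM hh; exact: pihomogP.
  by case: eqP => [<-|/eqP ne]; [exact: pihomog_dE|exact: pihomog_ne0 fh].
under eq_bigr do rewrite comp.
case: ifPn => [de|nde]; last first.
  by rewrite big1 // => i _; case: eqP => // ie; rewrite -ie leq_addl in nde.
have lt_e : (e - d < K)%N by rewrite leq_max ltnS leq_subr orbT.
rewrite (bigD1 (Ordinal lt_e)) //= subnK // eqxx big1 ?addr0 // => i.
by rewrite -val_eqE /= -(eqn_add2r d) subnK // => /negPf->.
Qed.

Lemma pihomogMl e d f h : h \is d.-homog ->
  pihomog mdeg e (h * f) = if (d <= e)%N then h * pihomog mdeg (e - d) f else 0.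
Proof. by move=> hh; rewrite mulrC (pihomogMr _ _ hh) mulrC. Qed.

Lemma homogeneous_pihomog J e f : homogeneous J -> f \in J -> pihomog mdeg e f \in J.
Proof.
move=> homJ; rewrite homJ => /asboolP[s sS ->]; rewrite raddf_sum /= big_seq.
apply: rpred_sum => x /sS[xJ [d xd]]; rewrite (pihomogMr _ _ xd).
by case: ifP => _; [apply: idealM|apply: ideal0].
Qed.

Lemma free_of_pihomog (j : 'I_n) e f : free_of j f -> free_of j (pihomog mdeg e f).
Proof.
move=> ff m; rewrite mcoeff_msupp mcoeff_pihomog.
by case: ifP => _; [rewrite -mcoeff_msupp; exact: ff|rewrite eqxx].
Qed.

End HomogeneousComponents.

(** * Multiplication by the common fraction, and its effect on degrees *)

Section Multiplication.
Variables (k : fieldType) (n : nat) (j : 'I_n).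
Local Notation R := {mpoly k[n]}.
Variables I C N : ideal R.

(* W f c says that c = (c' / (y c' + r')) f in the total ring of fractions of
   R/N for every y c' + r' in I, where y = 'X_j: the relation is the graph of
   the isomorphism. *)
Definition same_fraction (f c : R) : Prop :=
  forall c' r', linear_element j I c' r' -> c' * f - ('X_j * c' + r') * c \in N.

Lemma same_fraction_linear a f g c e : same_fraction f c -> same_fraction g e ->
  same_fraction (a * f + g) (a * c + e).
Proof.
move=> Wfc Wge c' r' lin; set h := 'X_j * c' + r'.
have -> : c' * (a * f + g) - h * (a * c + e) =
    a * (c' * f - h * c) + (c' * g - h * e).
  by rewrite !mulrDr mulrN mulrCA [h * (a * c)]mulrCA opprD addrACA.
by apply: idealD; [apply: idealM; exact: Wfc|exact: Wge].
Qed.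

Lemma same_fraction0 : same_fraction 0 0.
Proof. by move=> c' r' _; rewrite !mulr0 subr0 ideal0. Qed.

Hypothesis C_closed : ycoef_closed j C.
Hypothesis N_closed : ycoef_closed j N.
Hypothesis sub_NI : {subset N <= I}.
Hypothesis sub_NC : {subset N <= C}.
Hypothesis elimination : forall f, f \in I -> free_of j f -> f \in N.
Hypothesis top_coef : forall i f, f \in I ->
  (forall l, (i < l)%N -> ycoef j l f = 0) -> ycoef j i f \in C.
Hypothesis linear_lift : forall c, c \in C -> free_of j c ->
  exists r, linear_element j I c r.
Hypothesis I_unmixed : unmixed I.
Hypothesis N_unmixed : unmixed N.
Hypothesis nondegenerate : ~ degenerate C N.

Lemma same_fraction_linear_element c r : linear_element j I c r ->
  same_fraction ('X_j * c + r) c.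
Proof.
move=> lin c' r' lin'; have := linear_syzygy elimination lin' lin.
by rewrite mulrDr mulrDl opprD addrACA mulrCA mulrA subrr add0r [r' * c]mulrC.
Qed.

Lemma same_fraction_total f : f \in I -> exists2 c, c \in C & same_fraction f c.
Proof.
move: f; apply: (linear_elements_generate top_coef linear_lift).
  move=> c r lin; exists c; last exact: same_fraction_linear_element.
  exact: (linear_element_C top_coef lin).
move=> a f g [c cC Wfc] [e eC Wge]; exists (a * c + e).
  by apply: idealD => //; apply: idealM.
exact: same_fraction_linear.
Qed.

(** For each coefficient [c_i] of [c], lifted to ['X_j * c_i + r] in [I], the product of this lift
    with ['X_j ^+ i] is related to ['X_j ^+ i * c_i]. *)
Lemma same_fraction_surj c : c \in C -> exists2 f, f \in I & same_fraction f c.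
Proof.
move=> cC; rewrite (@ycoef_expansion _ _ j c (degree_in j c).+1); last first.
  by move=> i lt_i; apply: ycoef_gt_degree lt_i.
elim/big_ind: _ => [|c1 c2 [f1 f1I W1] [f2 f2I W2]|i _].
- by exists 0; [exact: ideal0|exact: same_fraction0].
- exists (f1 + f2); first exact: idealD.
  by have := same_fraction_linear 1 W1 W2; rewrite !mul1r.
have [r lin] := linear_lift (C_closed i cC) (@ycoef_free _ _ j i c).
exists ('X_j ^+ i * ('X_j * ycoef j i c + r)).
  by case: lin => _ _; exact: idealM.
have := same_fraction_linear ('X_j ^+ i) (same_fraction_linear_element lin)
  same_fraction0.
by rewrite !addr0.
Qed.

(** If [f] is in [N], the relation gives that [I] multiplies [c] into [N]; if [c] is, that [C]
    multiplies [f] into [N]. No associated prime of [N] contains [I] or [C], so both factors can be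
    cancelled. *)
Lemma same_fraction_N f c : same_fraction f c -> f \in N <-> c \in N.
Proof.
move=> Wfc; split=> [fN|cN].
  apply: (@colon_not_sub _ _ N I c).
    exact: (@not_sub_I _ _ j I C N).
  apply: (linear_elements_generate top_coef linear_lift) => [c' r' lin|a g h gN hN].
    have := idealB (idealM c' fN) (Wfc _ _ lin).
    by rewrite opprB addrC subrK.
  by rewrite mulrDl -mulrA; apply: idealD => //; apply: idealM.
apply: (@colon_not_sub _ _ N C f).
  exact: (@not_sub_C _ _ j I C N).
suff sub : {subset C <= colon N f} by move=> g /sub.
apply: (sub_C_free C_closed) => c' c'C fc'.
have [r' lin] := linear_lift c'C fc'; rewrite mem_colon.
by have := idealD (Wfc _ _ lin) (idealM ('X_j * c' + r') cN); rewrite subrK.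
Qed.

Hypothesis N_homogeneous : homogeneous N.
Hypothesis I_homogeneous : homogeneous I.

Lemma pihomog_linear (c r : R) i : pihomog mdeg i ('X_j * c + r) =
  (if i is i'.+1 then 'X_j * pihomog mdeg i' c else 0) + pihomog mdeg i r.
Proof.
have Xhom : ('X_j : R) \is 1.-homog by rewrite dhomogX; apply/eqP; exact: mdeg1.
by rewrite raddfD /= (pihomogMl _ _ Xhom); case: i => [|i] //=; rewrite subn1.
Qed.

Lemma linear_element_pihomog c r i : linear_element j I c r ->
  linear_element j I (pihomog mdeg i c) (pihomog mdeg i.+1 r).
Proof.
case=> fc fr gI; split; [exact: free_of_pihomog|exact: free_of_pihomog|].
by have := homogeneous_pihomog i.+1 I_homogeneous gI; rewrite pihomog_linear.
Qed.

Lemma linear_element_pihomog0 c r : linear_element j I c r ->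
  linear_element j I 0 (pihomog mdeg 0 r).
Proof.
case=> fc fr gI; split; [exact: free_of0|exact: free_of_pihomog|].
by have := homogeneous_pihomog 0 I_homogeneous gI; rewrite pihomog_linear mulr0.
Qed.

(** The relation is summed over degrees, degree [i] of [c'] being paired with degree [i.+1] of
    ['X_j * c' + r']. Degree 0 of the latter has no partner and needs its own condition. *)
Lemma same_fraction_homog f c :
    (forall c' r' i, linear_element j I c' r' ->
       pihomog mdeg i c' * f - pihomog mdeg i.+1 ('X_j * c' + r') * c \in N) ->
    (forall c' r', linear_element j I c' r' ->
       pihomog mdeg 0 ('X_j * c' + r') * c \in N) ->
  same_fraction f c.
Proof.
move=> comp comp0 c' r' lin; set g := 'X_j * c' + r'.
pose K := maxn (msize c') (msize g).
rewrite {1}(@pihomog_sum _ _ c' K) ?leq_maxl //.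
rewrite {1}(@pihomog_sum _ _ g K.+1) ?leqW ?leq_maxr //.
rewrite big_ord_recl mulrDl opprD addrCA ![(\sum_(i < K) _) * _]mulr_suml -sumrB.
apply: idealD; first by apply: idealN; exact: (comp0 _ _ lin).
by apply: rpred_sum => i _; exact: (comp _ _ i lin).
Qed.

(** This is degree [i + e] of the relation tested on a homogeneous linear element of degree [i.+1].
    That element meets [c] in degree [e - 1], absent if [e = 0]: hence the shift by one. *)
Lemma same_fraction_component c' r' f c i e : same_fraction f c ->
    linear_element j I c' r' ->
  pihomog mdeg i c' * pihomog mdeg e f -
    (if e is e'.+1 then
       pihomog mdeg i.+1 ('X_j * c' + r') * pihomog mdeg e' c else 0) \in N.
Proof.
move=> Wfc lin; have := Wfc _ _ (linear_element_pihomog i lin).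
rewrite -(pihomog_linear c' r' i.+1).
move=> /(homogeneous_pihomog (i + e) N_homogeneous); rewrite raddfB /=.
rewrite (pihomogMl _ _ (pihomogP _ _ _)) leq_addr addKn.
rewrite (pihomogMl _ _ (pihomogP _ _ _)); case: e => [|e].
  by rewrite addn0 ltnn.
by rewrite addnS ltnS leq_addr subSS addKn.
Qed.

Lemma same_fraction_component0 c' r' f c e : same_fraction f c ->
    linear_element j I c' r' ->
  pihomog mdeg 0 ('X_j * c' + r') * pihomog mdeg e c \in N.
Proof.
move=> Wfc lin; have := Wfc _ _ (linear_element_pihomog0 lin).
rewrite mul0r sub0r mulr0 add0r => /idealN; rewrite opprK.
move=> /(homogeneous_pihomog e N_homogeneous).
by rewrite (pihomogMl _ _ (pihomogP _ _ _)) leq0n subn0 pihomog_linear add0r.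
Qed.

Lemma same_fraction_pihomog f c e : same_fraction f c ->
  same_fraction (pihomog mdeg e.+1 f) (pihomog mdeg e c).
Proof.
move=> Wfc; apply: same_fraction_homog => [c' r' i|c' r'] lin.
  exact: (same_fraction_component i e.+1 Wfc lin).
exact: (same_fraction_component0 e Wfc lin).
Qed.

Lemma same_fraction_pihomog0 f c : same_fraction f c ->
  same_fraction (pihomog mdeg 0 f) 0.
Proof.
move=> Wfc; apply: same_fraction_homog => [c' r' i|c' r'] lin.
  by have := same_fraction_component i 0 Wfc lin; rewrite mulr0.
by rewrite mulr0 ideal0.
Qed.

End Multiplication.

Theorem theorem4p1 (k : fieldType)
  (k_infinite : forall s : seq k, exists x : k, x \notin s)
  (n : nat) (j : 'I_n) (I : ideal {mpoly k[n]})
  (le : rel 'X_{1..n}) (m : nat)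
  (d : 'I_m -> nat) (q r : 'I_m -> {mpoly k[n]})
  (le_order : monomial_order le) (le_compatible : compatible k j le)
  (basis : y_groebner_basis le j I d q r) :
  let C := C_ideal q in
  let N := N_ideal d q in
  unmixed I ->
  geometric_vertex_decomposition j I C N ->
  ~ degenerate C N ->
  unmixed N ->
  exists phi : {linear quo_mod I N -> quo_mod C N},
    bijective phi /\
    (homogeneous N -> homogeneous C -> homogeneous I -> graded_shifted phi).
Proof.
move=> C N I_unmixed gvd nondegenerate N_unmixed.
have C_closed : ycoef_closed j C := C_ideal_closed le_order le_compatible basis.
have N_closed : ycoef_closed j N := N_ideal_closed le_order le_compatible basis.
have sub_NI : {subset N <= I} := N_ideal_sub_I le_order le_compatible basis.
have sub_NC : {subset N <= C} := @N_ideal_sub_C _ _ _ d q.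
have elim_N f : f \in I -> free_of j f -> f \in N.
  exact: (groebner_elimination le_order le_compatible basis).
have top i f : f \in I -> (forall l, (i < l)%N -> ycoef j l f = 0) ->
    ycoef j i f \in C.
  exact: (groebner_top_coef_C le_order le_compatible basis).
have lift c : c \in C -> free_of j c -> exists r, linear_element j I c r.
  exact: (gvd_linear_lift gvd).
pose W := same_fraction j I N.
have [|||f c _ _|phi [phi_bij phi_val]] := @relation_isomorphism _ I C N W.
- exact: same_fraction_linear.
- exact: same_fraction_total.
- exact: same_fraction_surj.
- exact: (@same_fraction_N _ _ j I C N).
exists phi; split=> // N_hom C_hom I_hom e x.
have phi_inj := bij_inj phi_bij.
have zeroE : x = 0 <-> phi x = 0.
  by split=> [->|phi0]; [exact: linear0|apply: phi_inj; rewrite phi0 linear0].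
(* Degree 0 goes to degree -1, where the component is zero; for negative [e] both components are
   zero. *)
case: e => [[|e]|e]; last exact: zeroE.
- split=> [[f [fI fhom xf]]|/zeroE->]; last first.
    by exists 0; split; [exact: ideal0|exact: dhomog0|rewrite rmorph0].
  have [c cC Wfc] := same_fraction_total elim_N top lift fI.
  apply: val_inj; rewrite (phi_val f 0 x fI (ideal0 _) _ xf) ?rmorph0 //.
  have := same_fraction_pihomog0 N_hom I_hom Wfc.
  by rewrite (pihomog_dE fhom).
rewrite (_ : e.+1%:Z - 1 = e) /=; last by rewrite intS addrC addKr.
split=> [[f [fI fhom xf]]|[c [cC chom yc]]].
  have [c cC Wfc] := same_fraction_total elim_N top lift fI.
  have := same_fraction_pihomog N_hom I_hom e Wfc; rewrite (pihomog_dE fhom) => We.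
  have ceC := homogeneous_pihomog e C_hom cC.
  exists (pihomog mdeg e c); split; [exact: ceC|exact: pihomogP|].
  exact: phi_val fI ceC We xf.
(* Conversely, the component of degree [e.+1] of a preimage [f] is related to [c], and injectivity
   of [phi] identifies its class with [x]. *)
have [f fI Wfc] := same_fraction_surj C_closed elim_N lift cC.
have := same_fraction_pihomog N_hom I_hom e Wfc; rewrite (pihomog_dE chom) => We.
have feI := homogeneous_pihomog e.+1 I_hom fI.
have [z zf] := quo_mod_mk N feI.
exists (pihomog mdeg e.+1 f); split; [exact: feI|exact: pihomogP|].
rewrite -zf; congr val; apply: phi_inj; apply: val_inj.
exact: etrans yc (esym (phi_val _ _ _ feI cC We zf)).
Qed.
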